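(* Let $\mathcal G$ and $\mathcal H$ be Lie groupoids and let $\mathcal G\xleftarrow{\varphi}\mathcal K\xrightarrow{\psi}\mathcal H$ be a (diffeological) Morita equivalence between them, where $\mathcal K$ is a diffeological groupoid. Then there are a Lie groupoid $\mathcal K'$, a Lie anafunctor $\mathcal G\xleftarrow{\varphi'}\mathcal K'\xrightarrow{\psi'}\mathcal H$ that is a Morita equivalence, and a transformation between the two anafunctors. Thus Morita equivalence between two Lie groupoids in the diffeological sense is equivalent to Morita equivalence in the Lie sense.
   Context: Diffeology. A parametrisation of a set $X$ is a map $p\colon U_p\to X$ from an open subset $U_p$ of some $\mathbb{R}^n$, $n\ge 0$. A diffeology on $X$ is a set of parametrisations, called plots, containing all constant parametrisations, such that a parametrisation that restricts to a plot on each member of an open cover of its domain is a plot, and such that $p\circ f$ is a plot for every plot $p$ and every smooth map $f\colon V\to U_p$ from an open subset $V$ of some $\mathbb{R}^m$. A map $F\colon X\to Y$ of diffeological spaces is smooth if $F\circ p$ is a plot of $Y$ for every plot $p$ of $X$; a diffeomorphism is a smooth bijection with smooth inverse. A subset of $X$ carries the plots of $X$ with image in it; products carry the parametrisations whose components are plots; fibre products carry the subset diffeology of the product. A smooth surjection $F\colon X\to Y$ is a subduction if for every plot $p$ of $Y$ there are an open cover $\{U_\alpha\}$ of $U_p$ and plots $q_\alpha\colon U_\alpha\to X$ with $p|_{U_\alpha}=F\circ q_\alpha$. Manifolds are smooth, Hausdorff and second-countable unless stated otherwise, and are regarded as diffeological spaces whose plots are the smooth parametrisations. Diffeological groupoids.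 A diffeological groupoid $\mathcal G=(\mathcal G_1\rightrightarrows\mathcal G_0)$ is a small groupoid whose sets of objects $\mathcal G_0$ and arrows $\mathcal G_1$ are diffeological spaces such that the source $s$, target $t$, unit, multiplication ($gh$ defined when $s(g)=t(h)$) and inversion are smooth. A functor $\varphi\colon\mathcal G\to\mathcal H$ is smooth if its map on arrows is smooth (then so is its map on objects $\varphi_0$). A natural transformation $S$ between smooth functors $\mathcal G\to\mathcal H$ is smooth if $\mathcal G_0\to\mathcal H_1$, $x\mapsto S_x$, is smooth. Pullbacks $\mathcal K\times_{\varphi,\varphi'}\mathcal K'$ of smooth functors are strict: objects and arrows are the fibre products of the objects and of the arrows. Weak equivalences. A smooth functor $\varphi\colon\mathcal G\to\mathcal H$ is a weak equivalence if (i) $\Psi_\varphi\colon\{(x,h)\in\mathcal G_0\times\mathcal H_1:\varphi(x)=t(h)\}\to\mathcal H_0$, $(x,h)\mapsto s(h)$, is a subduction and (ii) $\Phi_\varphi\colon\mathcal G_1\to\{(x,x',h)\in\mathcal G_0\times\mathcal G_0\times\mathcal H_1: s(h)=\varphi(x),\,t(h)=\varphi(x')\}$, $g\mapsto(s(g),t(g),\varphi(g))$, is a diffeomorphism. It is a subductive weak equivalence if moreover $\varphi_0$ is a subduction. An anafunctor from $\mathcal G$ to $\mathcal H$ is a pair of smooth functors $\mathcal G\xleftarrow{\varphi}\mathcal K\xrightarrow{\psi}\mathcal H$ with $\varphi$ a subductive weak equivalence. It is a Morita equivalence if $\psi$ is also a weak equivalence; $\mathcal G$ and $\mathcal H$ are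 then Morita equivalent (in the diffeological sense). A transformation from $\mathcal G\xleftarrow{\varphi}\mathcal K\xrightarrow{\psi}\mathcal H$ to $\mathcal G\xleftarrow{\varphi'}\mathcal K'\xrightarrow{\psi'}\mathcal H$ is a smooth natural transformation $\psi\circ\mathrm{pr}_1\Rightarrow\psi'\circ\mathrm{pr}_2$ of functors $\mathcal K\times_{\varphi,\varphi'}\mathcal K'\to\mathcal H$. Lie groupoids. A Lie groupoid is a diffeological groupoid $\mathcal G$ with $\mathcal G_0$ a manifold and $\mathcal G_1$ a smooth manifold not required to be Hausdorff or second-countable, and $s,t$ submersions. A weak equivalence $\varphi\colon\mathcal G\to\mathcal H$ between Lie groupoids is Lie if $\Phi_\varphi$ and $\Psi_\varphi$ are smooth maps between manifolds and $\Psi_\varphi$ is a submersion; it is surjective submersive if it is Lie and $\varphi_0$ is a surjective submersion. An anafunctor $\mathcal G\xleftarrow{\varphi}\mathcal K\xrightarrow{\psi}\mathcal H$ between Lie groupoids is Lie if $\varphi$ is a surjective submersive weak equivalence (in particular $\mathcal K$ is Lie). Two Lie groupoids are Morita equivalent in the Lie sense if there is a Lie anafunctor between them whose right arrow is a Lie weak equivalence. *)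

(* Defs.v *)
From HB Require Import structures.
From mathcomp Require Import all_boot all_order all_algebra.
From mathcomp Require Import all_classical all_reals all_analysis.

Set Implicit Arguments.
Unset Strict Implicit.
Unset Printing Implicit Defensive.
Import Order.TTheory GRing.Theory Num.Theory.
Import numFieldNormedType.Exports.
Local Open Scope classical_set_scope.
Local Open Scope ring_scope.

(** * Smooth maps between open subsets of Euclidean spaces *)

(* Maps defined on an open set [U] are represented by total functions, of which
   only the values on [U] matter. [Ck k U f] says that all iterated partial
   derivatives of [f] of order at most [k] exist and are continuous on [U]. *)
Fixpoint Ck (R : realType) (n m k : nat) (U : set 'rV[R]_n)
    (f : 'rV[R]_n -> 'rV[R]_m) : Prop :=
  (forall x, U x -> {for x, continuous f}) /\
  (if k is k'.+1 then
     forall i : 'I_n,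
       (forall x, U x -> derivable f x (delta_mx 0 i)) /\
       Ck k' U ('D_(delta_mx 0 i) f)
   else True).

Definition smooth_on (R : realType) (n m : nat) (U : set 'rV[R]_n)
    (f : 'rV[R]_n -> 'rV[R]_m) : Prop :=
  forall k, Ck k U f.

(** * Diffeological spaces *)

(* [plot U p] says that [U] is open and that the restriction of [p] to [U] is a
   plot; [plot_ext] says that the values of [p] outside [U] are irrelevant. *)
Record diffSpace (R : realType) := DiffSpace {
  dcar :> Type;
  plot : forall n : nat, set 'rV[R]_n -> ('rV[R]_n -> dcar) -> Prop;
  plot_open : forall n (U : set 'rV[R]_n) p, plot U p -> open U;
  plot_ext : forall n (U : set 'rV[R]_n) p q,
    plot U p -> (forall z, U z -> p z = q z) -> plot U q;
  plot_cst : forall n (U : set 'rV[R]_n) (x : dcar),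
    open U -> plot U (fun=> x);
  plot_local : forall n (C : set (set 'rV[R]_n)) p,
    (forall V, C V -> plot V p) -> plot (\bigcup_(V in C) V) p;
  plot_comp : forall n m (U : set 'rV[R]_n) p (V : set 'rV[R]_m)
      (f : 'rV[R]_m -> 'rV[R]_n),
    plot U p -> open V -> smooth_on V f -> (forall z, V z -> U (f z)) ->
    plot V (p \o f)
}.

Definition dsmooth (R : realType) (X Y : diffSpace R) (F : X -> Y) : Prop :=
  forall n (U : set 'rV[R]_n) (p : 'rV[R]_n -> X), plot U p -> plot U (F \o p).

Definition diffeomorphism (R : realType) (X Y : diffSpace R) (F : X -> Y) :
    Prop :=
  dsmooth F /\ exists F' : Y -> X, [/\ cancel F F', cancel F' F & dsmooth F'].

Definition subduction (R : realType) (X Y : diffSpace R) (F : X -> Y) : Prop :=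
  [/\ dsmooth F,
      set_surj [set: X] [set: Y] F &
      forall n (U : set 'rV[R]_n) (p : 'rV[R]_n -> Y), plot U p ->
        exists C : set (set 'rV[R]_n),
          [/\ C `<=` open,
              \bigcup_(V in C) V = U &
              forall V, C V -> exists q : 'rV[R]_n -> X,
                plot V q /\ forall z, V z -> p z = F (q z)]].

Section SubsetDiffeology.
Context (R : realType) (X : diffSpace R) (P : X -> Prop).

Let splot n (U : set 'rV[R]_n) (p : 'rV[R]_n -> {x : X | P x}) : Prop :=
  plot U (fun z => sval (p z)).

Lemma subD_open n (U : set 'rV[R]_n) p : splot U p -> open U.
Proof. exact: plot_open. Qed.

Lemma subD_ext n (U : set 'rV[R]_n) p q :
  splot U p -> (forall z, U z -> p z = q z) -> splot U q.
Proof. by move=> pp pq; apply: (plot_ext pp) => z Uz; rewrite pq. Qed.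

Lemma subD_cst n (U : set 'rV[R]_n) (x : {x : X | P x}) :
  open U -> splot U (fun=> x).
Proof. exact: plot_cst. Qed.

Lemma subD_local n (C : set (set 'rV[R]_n)) p :
  (forall V, C V -> splot V p) -> splot (\bigcup_(V in C) V) p.
Proof. exact: plot_local. Qed.

Lemma subD_comp n m (U : set 'rV[R]_n) p (V : set 'rV[R]_m)
    (f : 'rV[R]_m -> 'rV[R]_n) :
  splot U p -> open V -> smooth_on V f -> (forall z, V z -> U (f z)) ->
  splot V (p \o f).
Proof. by move=> pp oV sf VU; exact: (plot_comp pp oV sf VU). Qed.

Definition subD : diffSpace R :=
  DiffSpace subD_open subD_ext subD_cst subD_local subD_comp.

End SubsetDiffeology.

Section ProductDiffeology.
Context (R : realType) (X Y : diffSpace R).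

Let pplot n (U : set 'rV[R]_n) (p : 'rV[R]_n -> X * Y) : Prop :=
  plot U (fun z => (p z).1) /\ plot U (fun z => (p z).2).

Lemma prodD_open n (U : set 'rV[R]_n) p : pplot U p -> open U.
Proof. by case=> + _; exact: plot_open. Qed.

Lemma prodD_ext n (U : set 'rV[R]_n) p q :
  pplot U p -> (forall z, U z -> p z = q z) -> pplot U q.
Proof.
move=> [p1 p2] pq.
by split; [apply: (plot_ext p1)|apply: (plot_ext p2)] => z Uz; rewrite pq.
Qed.

Lemma prodD_cst n (U : set 'rV[R]_n) (x : X * Y) :
  open U -> pplot U (fun=> x).
Proof. by move=> oU; split; exact: plot_cst. Qed.

Lemma prodD_local n (C : set (set 'rV[R]_n)) p :
  (forall V, C V -> pplot V p) -> pplot (\bigcup_(V in C) V) p.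
Proof. by move=> Cp; split; apply: plot_local => V /Cp[]. Qed.

Lemma prodD_comp n m (U : set 'rV[R]_n) p (V : set 'rV[R]_m)
    (f : 'rV[R]_m -> 'rV[R]_n) :
  pplot U p -> open V -> smooth_on V f -> (forall z, V z -> U (f z)) ->
  pplot V (p \o f).
Proof.
move=> [p1 p2] oV sf VU.
by split; [exact: (plot_comp p1 oV sf VU)|exact: (plot_comp p2 oV sf VU)].
Qed.

Definition prodD : diffSpace R :=
  DiffSpace prodD_open prodD_ext prodD_cst prodD_local prodD_comp.

End ProductDiffeology.

Definition fibD (R : realType) (X Y Z : diffSpace R) (f : X -> Z) (g : Y -> Z) :
    diffSpace R :=
  @subD R (prodD X Y) (fun xy => f xy.1 = g xy.2).

(** * Manifolds *)

(* A chart is given by its inverse, an injective parametrisation. *)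
Record chart (R : realType) (X : Type) (n : nat) := Chart {
  cdom : set 'rV[R]_n;
  cmap : 'rV[R]_n -> X;
  cdom_open : open cdom;
  cmap_inj : set_inj cdom cmap
}.

(* [p], defined on the open set [U], is continuous and smooth when read in the
   chart [c]: it meets the image of [c] in an open set, on which c^-1 o p is
   smooth. *)
Definition smooth_in_chart (R : realType) (X : Type) (n m : nat)
    (c : chart R X n) (U : set 'rV[R]_m) (p : 'rV[R]_m -> X) : Prop :=
  let W := U `&` p @^-1` (cmap c @` cdom c) in
  open W /\
  exists f : 'rV[R]_m -> 'rV[R]_n,
    smooth_on W f /\ forall z, W z -> cdom c (f z) /\ cmap c (f z) = p z.

Definition is_atlas (R : realType) (X : Type) (n : nat)
    (A : set (chart R X n)) : Prop :=
  \bigcup_(c in A) (cmap c @` cdom c) = [set: X] /\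
  forall c c', A c -> A c' -> smooth_in_chart c' (cdom c) (cmap c).

Definition smooth_parametrisation (R : realType) (X : Type) (n m : nat)
    (A : set (chart R X n)) (U : set 'rV[R]_m) (p : 'rV[R]_m -> X) : Prop :=
  open U /\ forall c, A c -> smooth_in_chart c U p.

(* [X] with the topology determined by the charts in [A] *)
Definition atlas_space (R : realType) (X : Type) (n : nat)
  (A : set (chart R X n)) : Type := X.

Section AtlasTopology.
Context (R : realType) (X : Type) (n : nat) (A : set (chart R X n)).

Definition atlas_open (O : set X) : Prop :=
  forall c, A c -> open (cdom c `&` cmap c @^-1` O).

Lemma atlas_openT : atlas_open setT.
Proof. by move=> c _; rewrite preimage_setT setIT; exact: cdom_open. Qed.

Lemma atlas_openI : setI_closed atlas_open.
Proof.
move=> O O' oO oO' c Ac.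
by rewrite preimage_setI setIIr; apply: openI; [exact: oO|exact: oO'].
Qed.

Lemma atlas_open_bigcup (I : Type) (f : I -> set X) :
  (forall i, atlas_open (f i)) -> atlas_open (\bigcup_i f i).
Proof.
move=> of_ c Ac; rewrite preimage_bigcup setI_bigcupr.
by apply: bigcup_open => i _; exact: of_.
Qed.

HB.instance Definition _ := gen_eqMixin (atlas_space A).
HB.instance Definition _ := gen_choiceMixin (atlas_space A).
HB.instance Definition _ := isOpenTopological.Build (atlas_space A)
  atlas_openT atlas_openI atlas_open_bigcup.

End AtlasTopology.

Definition manifold_atlas (R : realType) (X : diffSpace R) (n : nat)
    (A : set (chart R X n)) : Prop :=
  is_atlas A /\
  forall m (U : set 'rV[R]_m) (p : 'rV[R]_m -> X),
    plot U p <-> smooth_parametrisation A U p.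

(* not required to be Hausdorff or second countable, as the space of arrows of a
   Lie groupoid *)
Definition weak_manifold (R : realType) (X : diffSpace R) : Prop :=
  exists (n : nat) (A : set (chart R X n)), manifold_atlas A.

Definition manifold (R : realType) (X : diffSpace R) : Prop :=
  exists (n : nat) (A : set (chart R X n)),
    [/\ manifold_atlas A,
        hausdorff_space (atlas_space A) &
        @second_countable (atlas_space A)].

(* [f] is the expression of [F] in the charts [c] and [d] near [z] *)
Definition submersion (R : realType) (X Y : diffSpace R) (F : X -> Y) : Prop :=
  dsmooth F /\
  exists (n m : nat) (A : set (chart R X n)) (B : set (chart R Y m)),
    [/\ manifold_atlas A,
        manifold_atlas B &
        forall c d z, A c -> B d -> cdom c z ->
          (cmap d @` cdom d) (F (cmap c z)) ->
          exists (W : set 'rV[R]_n) (f : 'rV[R]_n -> 'rV[R]_m),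
            [/\ open W /\ W z,
                W `<=` cdom c,
                smooth_on W f,
                forall y, W y -> cdom d (f y) /\ cmap d (f y) = F (cmap c y) &
                set_surj [set: 'rV[R]_n] [set: 'rV[R]_m] ('d f z)]].

(** * Diffeological groupoids *)

Record dgroupoid (R : realType) := DGroupoid {
  ob : diffSpace R;
  ar : diffSpace R;
  src : ar -> ob;
  tgt : ar -> ob;
  unt : ob -> ar;
  inv : ar -> ar;
  mul : forall g h : ar, src g = tgt h -> ar;
  src_unt : forall x, src (unt x) = x;
  tgt_unt : forall x, tgt (unt x) = x;
  src_inv : forall g, src (inv g) = tgt g;
  tgt_inv : forall g, tgt (inv g) = src g;
  src_mul : forall g h (e : src g = tgt h), src (mul e) = src h;
  tgt_mul : forall g h (e : src g = tgt h), tgt (mul e) = tgt g;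
  mul_assoc : forall f g h (e : src f = tgt g) (e' : src g = tgt h)
      (el : src (mul e) = tgt h) (er : src f = tgt (mul e')),
    mul el = mul er;
  mul_unt_l : forall g (e : src (unt (tgt g)) = tgt g), mul e = g;
  mul_unt_r : forall g (e : src g = tgt (unt (src g))), mul e = g;
  mul_inv_l : forall g (e : src (inv g) = tgt g), mul e = unt (src g);
  mul_inv_r : forall g (e : src g = tgt (inv g)), mul e = unt (tgt g);
  src_smooth : dsmooth src;
  tgt_smooth : dsmooth tgt;
  unt_smooth : dsmooth unt;
  inv_smooth : dsmooth inv;
  mul_smooth : @dsmooth R (fibD src tgt) ar (fun gh => mul (proj2_sig gh))
}.

Record dfunctor (R : realType) (G H : dgroupoid R) := DFunctor {
  fob : ob G -> ob H;
  far : ar G -> ar H;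
  far_src : forall g, src (far g) = fob (src g);
  far_tgt : forall g, tgt (far g) = fob (tgt g);
  far_unt : forall x, far (unt x) = unt (fob x);
  far_mul : forall (g h : ar G) (e : src g = tgt h)
      (e' : src (far g) = tgt (far h)),
    far (mul e) = mul e';
  far_smooth : dsmooth far
}.

Lemma eq_mul (R : realType) (G : dgroupoid R) (g g' h h' : ar G)
    (e : src g = tgt h) (e' : src g' = tgt h') :
  g = g' -> h = h' -> mul e = mul e'.
Proof. by move=> gg' hh'; subst; congr mul. Qed.

Lemma far_inv (R : realType) (G H : dgroupoid R) (phi : dfunctor G H)
    (g : ar G) : far phi (inv g) = inv (far phi g).
Proof.
have e1 : src (inv g) = tgt g by rewrite src_inv.
have e2 : src (far phi (inv g)) = tgt (far phi g) by rewrite far_src far_tgt e1.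
have fE : mul e2 = unt (src (far phi g)).
  by rewrite -(far_mul e1 e2) mul_inv_l far_unt far_src.
have e3 : src (far phi g) = tgt (inv (far phi g)) by rewrite tgt_inv.
have e4 : src (mul e2) = tgt (inv (far phi g)) by rewrite src_mul.
have e5 : src (far phi (inv g)) = tgt (mul e3) by rewrite tgt_mul.
have e6 : src (unt (tgt (inv (far phi g)))) = tgt (inv (far phi g)).
  by rewrite src_unt.
have e7 : src (far phi (inv g)) = tgt (unt (src (far phi (inv g)))).
  by rewrite tgt_unt.
have := mul_assoc e4 e5.
rewrite (eq_mul e4 e6 _ erefl); last by rewrite fE tgt_inv.
rewrite (eq_mul e5 e7 erefl); last by rewrite mul_inv_r e2.
by rewrite mul_unt_l mul_unt_r.
Qed.

Section Composition.
Context (R : realType) (G H K : dgroupoid R).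
Context (psi : dfunctor H K) (phi : dfunctor G H).

Let cob : ob G -> ob K := fob psi \o fob phi.
Let car : ar G -> ar K := far psi \o far phi.

Lemma fcomp_src g : src (car g) = cob (src g).
Proof. by rewrite /car /cob /= !far_src. Qed.

Lemma fcomp_tgt g : tgt (car g) = cob (tgt g).
Proof. by rewrite /car /cob /= !far_tgt. Qed.

Lemma fcomp_unt x : car (unt x) = unt (cob x).
Proof. by rewrite /car /cob /= !far_unt. Qed.

Lemma fcomp_mul (g h : ar G) (e : src g = tgt h)
    (e' : src (car g) = tgt (car h)) : car (mul e) = mul e'.
Proof.
rewrite /car /=.
have e1 : src (far phi g) = tgt (far phi h) by rewrite far_src far_tgt e.
by rewrite (far_mul e e1) (far_mul e1 e').
Qed.

Lemma fcomp_smooth : dsmooth car.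
Proof. by move=> n U p /(far_smooth phi)/(far_smooth psi). Qed.

Definition fcomp : dfunctor G K :=
  DFunctor fcomp_src fcomp_tgt fcomp_unt fcomp_mul fcomp_smooth.

End Composition.

(* [S] is a smooth natural transformation from [phi] to [psi]. *)
Definition smooth_nat_trans (R : realType) (G H : dgroupoid R)
    (phi psi : dfunctor G H) (S : ob G -> ar H) : Prop :=
  [/\ dsmooth S,
      forall x, src (S x) = fob phi x,
      forall x, tgt (S x) = fob psi x &
      forall (g : ar G) (e : src (S (tgt g)) = tgt (far phi g))
          (e' : src (far psi g) = tgt (S (src g))),
        mul e = mul e'].

(** * Strict pullbacks of groupoids *)

Section Pullback.
Context (R : realType) (K K' G : dgroupoid R).
Context (phi : dfunctor K G) (phi' : dfunctor K' G).

Let pbo : diffSpace R := fibD (fob phi) (fob phi').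
Let pba : diffSpace R := fibD (far phi) (far phi').

Lemma pb_eqo (x y : pbo) :
  (sval x).1 = (sval y).1 -> (sval x).2 = (sval y).2 -> x = y.
Proof.
by case: x => -[x x'] ex; case: y => -[y y'] ey /= e e'; apply: eq_exist;
  rewrite e e'.
Qed.

Lemma pb_eqa (x y : pba) :
  (sval x).1 = (sval y).1 -> (sval x).2 = (sval y).2 -> x = y.
Proof.
by case: x => -[x x'] ex; case: y => -[y y'] ey /= e e'; apply: eq_exist;
  rewrite e e'.
Qed.

Lemma pb_src_subproof (k : pba) :
  fob phi (src (sval k).1) = fob phi' (src (sval k).2).
Proof. by rewrite -!far_src (svalP k). Qed.

Lemma pb_tgt_subproof (k : pba) :
  fob phi (tgt (sval k).1) = fob phi' (tgt (sval k).2).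
Proof. by rewrite -!far_tgt (svalP k). Qed.

Lemma pb_unt_subproof (x : pbo) :
  far phi (unt (sval x).1) = far phi' (unt (sval x).2).
Proof. by rewrite !far_unt (svalP x). Qed.

Lemma pb_inv_subproof (k : pba) :
  far phi (inv (sval k).1) = far phi' (inv (sval k).2).
Proof. by rewrite !far_inv (svalP k). Qed.

Definition pb_src (k : pba) : pbo := exist _ (_, _) (pb_src_subproof k).
Definition pb_tgt (k : pba) : pbo := exist _ (_, _) (pb_tgt_subproof k).
Definition pb_unt (x : pbo) : pba := exist _ (_, _) (pb_unt_subproof x).
Definition pb_inv (k : pba) : pba := exist _ (_, _) (pb_inv_subproof k).

Lemma pb_mul1 (k l : pba) :
  pb_src k = pb_tgt l -> src (sval k).1 = tgt (sval l).1.
Proof. by move=> /(congr1 (fun x => (sval x).1)). Qed.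

Lemma pb_mul2 (k l : pba) :
  pb_src k = pb_tgt l -> src (sval k).2 = tgt (sval l).2.
Proof. by move=> /(congr1 (fun x => (sval x).2)). Qed.

Lemma pb_mul_subproof (k l : pba) (e : pb_src k = pb_tgt l) :
  far phi (mul (pb_mul1 e)) = far phi' (mul (pb_mul2 e)).
Proof.
have e1 : src (far phi (sval k).1) = tgt (far phi (sval l).1).
  by rewrite far_src far_tgt (pb_mul1 e).
have e2 : src (far phi' (sval k).2) = tgt (far phi' (sval l).2).
  by rewrite far_src far_tgt (pb_mul2 e).
rewrite (far_mul (pb_mul1 e) e1) (far_mul (pb_mul2 e) e2).
exact: (eq_mul e1 e2 (svalP k) (svalP l)).
Qed.

Definition pb_mul (k l : pba) (e : pb_src k = pb_tgt l) : pba :=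
  exist _ (mul (pb_mul1 e), mul (pb_mul2 e)) (pb_mul_subproof e).

Lemma pb_src_unt x : pb_src (pb_unt x) = x.
Proof. by apply: pb_eqo => /=; rewrite src_unt. Qed.

Lemma pb_tgt_unt x : pb_tgt (pb_unt x) = x.
Proof. by apply: pb_eqo => /=; rewrite tgt_unt. Qed.

Lemma pb_src_inv k : pb_src (pb_inv k) = pb_tgt k.
Proof. by apply: pb_eqo => /=; rewrite src_inv. Qed.

Lemma pb_tgt_inv k : pb_tgt (pb_inv k) = pb_src k.
Proof. by apply: pb_eqo => /=; rewrite tgt_inv. Qed.

Lemma pb_src_mul k l (e : pb_src k = pb_tgt l) : pb_src (pb_mul e) = pb_src l.
Proof. by apply: pb_eqo => /=; rewrite src_mul. Qed.

Lemma pb_tgt_mul k l (e : pb_src k = pb_tgt l) : pb_tgt (pb_mul e) = pb_tgt k.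
Proof. by apply: pb_eqo => /=; rewrite tgt_mul. Qed.

Lemma pb_mul_assoc f g h (e : pb_src f = pb_tgt g) (e' : pb_src g = pb_tgt h)
    (el : pb_src (pb_mul e) = pb_tgt h) (er : pb_src f = pb_tgt (pb_mul e')) :
  pb_mul el = pb_mul er.
Proof. by apply: pb_eqa => /=; exact: mul_assoc. Qed.

Lemma pb_mul_unt_l g (e : pb_src (pb_unt (pb_tgt g)) = pb_tgt g) :
  pb_mul e = g.
Proof. by apply: pb_eqa => /=; exact: mul_unt_l. Qed.

Lemma pb_mul_unt_r g (e : pb_src g = pb_tgt (pb_unt (pb_src g))) :
  pb_mul e = g.
Proof. by apply: pb_eqa => /=; exact: mul_unt_r. Qed.

Lemma pb_mul_inv_l g (e : pb_src (pb_inv g) = pb_tgt g) :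
  pb_mul e = pb_unt (pb_src g).
Proof. by apply: pb_eqa => /=; exact: mul_inv_l. Qed.

Lemma pb_mul_inv_r g (e : pb_src g = pb_tgt (pb_inv g)) :
  pb_mul e = pb_unt (pb_tgt g).
Proof. by apply: pb_eqa => /=; exact: mul_inv_r. Qed.

Lemma pb_src_smooth : dsmooth pb_src.
Proof. by move=> n U p [p1 p2]; split; exact: src_smooth. Qed.

Lemma pb_tgt_smooth : dsmooth pb_tgt.
Proof. by move=> n U p [p1 p2]; split; exact: tgt_smooth. Qed.

Lemma pb_unt_smooth : dsmooth pb_unt.
Proof. by move=> n U p [p1 p2]; split; exact: unt_smooth. Qed.

Lemma pb_inv_smooth : dsmooth pb_inv.
Proof. by move=> n U p [p1 p2]; split; exact: inv_smooth. Qed.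

Lemma pb_mul_smooth :
  @dsmooth R (fibD pb_src pb_tgt) pba (fun kl => pb_mul (proj2_sig kl)).
Proof.
move=> n U p [[p1 p2] [q1 q2]]; split.
- pose r z : fibD (@src R K) (@tgt R K) :=
    exist _ (_, _) (pb_mul1 (proj2_sig (p z))).
  have pr : plot U r by split.
  exact: (mul_smooth pr).
- pose r z : fibD (@src R K') (@tgt R K') :=
    exist _ (_, _) (pb_mul2 (proj2_sig (p z))).
  have pr : plot U r by split.
  exact: (mul_smooth pr).
Qed.

Definition pullback : dgroupoid R :=
  DGroupoid pb_src_unt pb_tgt_unt pb_src_inv pb_tgt_inv pb_src_mul pb_tgt_mul
    pb_mul_assoc pb_mul_unt_l pb_mul_unt_r pb_mul_inv_l pb_mul_inv_r
    pb_src_smooth pb_tgt_smooth pb_unt_smooth pb_inv_smooth pb_mul_smooth.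

Definition pb_pr1 : dfunctor pullback K.
Proof.
apply: (@DFunctor R pullback K (fun x => (sval x).1) (fun k => (sval k).1)).
- by [].
- by [].
- by [].
- by move=> g h e e'; exact: eq_mul.
- by move=> n U p [].
Defined.

Definition pb_pr2 : dfunctor pullback K'.
Proof.
apply: (@DFunctor R pullback K' (fun x => (sval x).2) (fun k => (sval k).2)).
- by [].
- by [].
- by [].
- by move=> g h e e'; exact: eq_mul.
- by move=> n U p [].
Defined.

End Pullback.

(** * Weak equivalences *)

Section WeakEquivalence.
Context (R : realType) (G H : dgroupoid R) (phi : dfunctor G H).

Definition Psi_dom : diffSpace R := fibD (fob phi) (@tgt R H).
Definition Psi (xh : Psi_dom) : ob H := src (sval xh).2.

Definition Phi_cod : diffSpace R :=
  @subD R (prodD (prodD (ob G) (ob G)) (ar H))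
    (fun z => src z.2 = fob phi z.1.1 /\ tgt z.2 = fob phi z.1.2).
Definition Phi (g : ar G) : Phi_cod :=
  exist _ (src g, tgt g, far phi g) (conj (far_src phi g) (far_tgt phi g)).

Definition weak_equivalence : Prop := subduction Psi /\ diffeomorphism Phi.

Definition subductive_weak_equivalence : Prop :=
  weak_equivalence /\ subduction (fob phi).

End WeakEquivalence.

(** * Anafunctors and transformations *)

Record anafunctor (R : realType) (G H : dgroupoid R) := Anafunctor {
  apex : dgroupoid R;
  aleft : dfunctor apex G;
  aright : dfunctor apex H;
  aleft_swe : subductive_weak_equivalence aleft
}.

Definition is_morita (R : realType) (G H : dgroupoid R) (M : anafunctor G H) :
    Prop :=
  weak_equivalence (aright M).

Definition morita_equivalent (R : realType) (G H : dgroupoid R) : Prop :=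
  exists M : anafunctor G H, is_morita M.

Definition transformation (R : realType) (G H : dgroupoid R)
    (M N : anafunctor G H) (S : ob (pullback (aleft M) (aleft N)) -> ar H) :
    Prop :=
  smooth_nat_trans
    (fcomp (aright M) (pb_pr1 (aleft M) (aleft N)))
    (fcomp (aright N) (pb_pr2 (aleft M) (aleft N))) S.

(** * Lie groupoids *)

Definition lie_groupoid (R : realType) (G : dgroupoid R) : Prop :=
  [/\ manifold (ob G),
      weak_manifold (ar G),
      submersion (@src R G) &
      submersion (@tgt R G)].

(* The fibre products below involve the manifolds of arrows, hence are not
   required to be Hausdorff or second countable. *)
Definition lie_weak_equivalence (R : realType) (G H : dgroupoid R)
    (phi : dfunctor G H) : Prop :=
  [/\ weak_equivalence phi,
      weak_manifold (Phi_cod phi) /\ dsmooth (@Phi R G H phi),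
      weak_manifold (Psi_dom phi) /\ dsmooth (@Psi R G H phi) &
      submersion (@Psi R G H phi)].

Definition surjective_submersive_weak_equivalence (R : realType)
    (G H : dgroupoid R) (phi : dfunctor G H) : Prop :=
  [/\ lie_weak_equivalence phi,
      submersion (fob phi) &
      set_surj [set: ob G] [set: ob H] (fob phi)].

(* only meant for Lie groupoids [G] and [H] *)
Definition lie_anafunctor (R : realType) (G H : dgroupoid R)
    (M : anafunctor G H) : Prop :=
  lie_groupoid (apex M) /\ surjective_submersive_weak_equivalence (aleft M).

Definition lie_morita_equivalent (R : realType) (G H : dgroupoid R) : Prop :=
  exists M : anafunctor G H,
    lie_anafunctor M /\ lie_weak_equivalence (aright M).

(* Main.v *)
From HB Require Import structures.
Require Import Defs.
From mathcomp Require Import all_boot all_order all_algebra.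
From mathcomp Require Import all_classical all_reals all_analysis.
From mathcomp Require Import ring lra.
(* again, because [mul] is shadowed by a name of mathcomp *)
Require Import Defs.

(* The object map of [phi] is a subduction, so it has smooth sections over the
   members of a countable family of open sets covering the manifold [ob G]. Let
   [X] be the disjoint union of these open sets and [K'] the groupoid induced by
   [G] on [X], whose arrows from [x] to [x'] are the arrows of [G] between their
   images. Since [phi] is fully faithful, the sections extend to a functor
   [tau : K' -> K] over [G]; the new anafunctor is [G <- K' -> H], with right arrow
   [psi o tau]. The transformation at [(k, x)] is the image under [psi] of the
   unique arrow from [k] to [tau x] over a unit of [G].

   Between manifolds, a smooth map is a submersion iff every plot of its target
   lifts locally through every prescribed point of its source: this is where the
   inverse function theorem enters, which also makes a fibre product along a
   submersion a manifold. For a weak equivalence, [Psi] has this lifting property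
   as soon as the target map of its domain does, because a lift through one point
   of a fibre can be translated by arrows to any other point of that fibre. So the
   diffeological condition on [Psi] already gives the Lie one. *)

Set Implicit Arguments.
Unset Strict Implicit.
Unset Printing Implicit Defensive.
Import Order.TTheory GRing.Theory Num.Theory.
Import numFieldNormedType.Exports.
Local Open Scope classical_set_scope.
Local Open Scope ring_scope.

(** * Calculus of several real variables *)

(** [K] carries no manifold structure and [fob phi] need not have a global section, so [K] is
    reached only through local sections. These need not agree on overlaps, whence the disjoint
    union. Its sheets are taken among the members of a countable base of [ob G]: this makes the
    union second countable, as the objects of a Lie groupoid must be.

    Manifolds and diffeologies meet in two notions that mention plots only: [dchart], a chart tested
    against all plots, and [local_subduction], lifting through a prescribed point. New spaces
    receive their charts, and new maps their submersivity, in these terms.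

    Since smoothness is defined by iterated partial derivatives, the calculus is done on real-valued
    coordinates ([sCk]), where closure properties are inductions on the order and total
    differentiability comes from continuous partials.

    Partial composition of arrows and the inverse of [Phi] are replaced by total functions ([cmp],
    and [L] in [Phi_lift]), so that plots can be composed without carrying proofs of
    composability. *)

Section MeanValue.
Context (R : realType) (n : nat).
Implicit Types (f : 'rV[R]_n -> R) (a v : 'rV[R]_n).

Lemma is_derive_line f a v (t : R) : derivable f (a + t *: v) v ->
  is_derive t 1 (fun t => f (a + t *: v)) ('D_v f (a + t *: v)).
Proof.
pose g (t : R) := f (a + t *: v).
have E : (fun h : R => h^-1 *: (g (h *: (1 : R) + t) - g t)) =
         (fun h : R => h^-1 *: (f (h *: v + (a + t *: v)) - f (a + t *: v))).
  apply/funext => h; rewrite /g; congr (_ *: (f _ - _)).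
  by rewrite [h *: _]mulr1 scalerDl addrCA.
by move=> df; split; rewrite /derivable /derive E.
Qed.

(** The bounds by [Num.min] and [Num.max] treat both signs of [h] at once: the coordinate increments
    in [grad_estimate] have arbitrary sign. *)
Lemma MVT_line f a v (h : R) :
  (forall t, Num.min 0 h <= t <= Num.max 0 h -> derivable f (a + t *: v) v) ->
  exists2 c, Num.min 0 h <= c <= Num.max 0 h &
    f (a + h *: v) - f a = h * 'D_v f (a + c *: v).
Proof.
move=> df; have g0 : f a = f (a + (0 : R) *: v) by rewrite scale0r addr0.
pose g (t : R) := f (a + t *: v); pose dg (t : R) := 'D_v f (a + t *: v).
have mvt (x y : R) : x <= y ->
    (forall t, t \in `[x, y] -> Num.min 0 h <= t <= Num.max 0 h) ->
    exists2 c, c \in `[x, y] & g y - g x = dg c * (y - x).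
  move=> xy sub; apply: MVT_segment => // [t txy|].
    by apply/is_derive_line/df/sub; apply: subset_itv_oo_cc.
  apply: derivable_within_continuous => t /sub /df /is_derive_line.
  by case.
move: mvt; have [h0|h0] := leP 0 h => mvt.
- have [|c cI e] := mvt 0 h h0.
    by move=> t; rewrite in_itv.
  exists c; first by rewrite in_itv in cI.
  by rewrite g0 -[LHS]/(g h - g 0) e subr0 mulrC.
- have [|c cI e] := mvt h 0 (ltW h0).
    by move=> t; rewrite in_itv.
  exists c; first by rewrite in_itv in cI.
  by rewrite g0 -[LHS]/(g h - g 0) -opprB e sub0r mulrN opprK mulrC.
Qed.

Lemma between0_norm (h t : R) :
  Num.min 0 h <= t <= Num.max 0 h -> `|t| <= `|h|.
Proof.
have [h0|h0] := leP 0 h => /andP[t1 t2]; first by rewrite (ger0_norm t1) (ger0_norm h0).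
by rewrite (ler0_norm t2) (ler0_norm (ltW h0)) lerN2.
Qed.

End MeanValue.

Section Norm.
Context (R : realType) (n : nat).
Implicit Types (x y : 'rV[R]_n).

Lemma rV_norm_coord x i : `|x 0 i| <= `|x|.
Proof.
rewrite [leRHS]/Num.Def.normr/= mx_normrE.
exact: (le_bigmax _ _ (0, i)).
Qed.

Lemma rV_norm_le x e : 0 <= e -> (forall i, `|x 0 i| <= e) -> `|x| <= e.
Proof.
move=> e0 H; rewrite [leLHS]/Num.Def.normr/= mx_normrE.
by apply: bigmax_le => // -[i j] _ /=; rewrite ord1.
Qed.

Lemma open_ballP (U : set 'rV[R]_n) x : open U -> U x ->
  exists2 e, 0 < e & forall y, `|y - x| < e -> U y.
Proof.
move=> oU Ux.
have /nbhs_ballP[e e0 H] : nbhs x U by apply: open_nbhs_nbhs.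
exists e => // y yx; apply: H; rewrite -ball_normE /ball_ /=.
by rewrite distrC.
Qed.
End Norm.

(** * Real-valued functions of class C^k and their algebra *)

Section ScalarCk.
Context (R : realType).

(* the analogue of [Ck] for real-valued functions *)
Fixpoint sCk n (k : nat) (U : set 'rV[R]_n) (f : 'rV[R]_n -> R) : Prop :=
  (forall x, U x -> {for x, continuous f}) /\
  (if k is k'.+1 then
     forall i : 'I_n,
       (forall x, U x -> derivable f x (delta_mx 0 i)) /\
       sCk k' U ('D_(delta_mx 0 i) f)
   else True).

Section Fixedn.
Context (n : nat).
Implicit Types (U V : set 'rV[R]_n) (f g : 'rV[R]_n -> R) (x y : 'rV[R]_n).

Lemma sCk_cont k U f x : sCk k U f -> U x -> {for x, continuous f}.
Proof. by case: k => [|k] [+ _]; exact. Qed.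

Lemma sCk_S k U f : sCk k.+1 U f -> sCk k U f.
Proof.
elim: k f => [|k IH] f; first by case.
by move=> [fc fd]; split=> // i; have [di Di] := fd i; split=> //; exact: IH.
Qed.

Lemma sCk_sub k U V f : V `<=` U -> sCk k U f -> sCk k V f.
Proof.
move=> VU; elim: k f => [|k IH] f [fc fd]; split=> //;
  try by move=> x /VU; exact: fc.
move=> i; have [di Di] := fd i; split; last exact: IH.
by move=> x /VU; exact: di.
Qed.

Lemma near_eq_in (T : Type) U (f g : 'rV[R]_n -> T) x :
  open U -> U x -> (forall y, U y -> f y = g y) -> \near x, f x = g x.
Proof.
move=> oU Ux fg; have /filterS : U `<=` [set y | f y = g y] by [].
by apply; exact: open_nbhs_nbhs.
Qed.

Lemma continuous_ext_in (T : topologicalType) U (f g : 'rV[R]_n -> T) x :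
  open U -> U x -> (forall y, U y -> f y = g y) ->
  {for x, continuous f} -> {for x, continuous g}.
Proof.
move=> oU Ux fg; rewrite /prop_for /continuous_at -(fg x Ux) => fc.
move=> A /fc fA.
have /filterS2 := near_eq_in oU Ux fg; apply; last exact: fA.
by move=> y /= <-.
Qed.

Lemma sCk_ext k U f g : open U -> (forall x, U x -> f x = g x) ->
  sCk k U f -> sCk k U g.
Proof.
move=> oU; elim: k f g => [|k IH] f g fg [fc fd].
  by split=> // x Ux; apply: (continuous_ext_in oU Ux fg); exact: fc.
split=> [x Ux|i].
  by apply: (continuous_ext_in oU Ux fg); exact: fc.
have [di Di] := fd i; split.
  move=> x Ux; apply: near_eq_derivable (di _ Ux).
  exact: (near_eq_in oU).
apply: IH Di => x Ux; apply: near_eq_derive.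
exact: (near_eq_in oU).
Qed.

Lemma sCk_cst k U (c : R) : sCk k U (fun=> c).
Proof.
elim: k c => [|k IH] c; split=> //; try by move=> x _; exact: cst_continuous.
move=> i; split=> [x _|]; first exact: derivable_cst.
rewrite (_ : 'D__ _ = fun=> 0)//.
by apply/funext => x; rewrite derive_cst.
Qed.

Lemma sCkD k U f g : open U -> sCk k U f -> sCk k U g ->
  sCk k U (fun x => f x + g x).
Proof.
move=> oU; elim: k f g => [|k IH] f g [fc fd] [gc gd]; split=> //.
- by move=> x Ux; apply: continuousD; [exact: fc|exact: gc].
- by move=> x Ux; apply: continuousD; [exact: fc|exact: gc].
- move=> i; have [di Di] := fd i; have [ei Ei] := gd i; split=> [x Ux|].
    by apply: derivableD; [exact: di|exact: ei].
  apply: sCk_ext (IH _ _ Di Ei) => // x Ux.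
  by rewrite deriveD//; [exact: di|exact: ei].
Qed.

Lemma sCkM k U f g : open U -> sCk k U f -> sCk k U g ->
  sCk k U (fun x => f x * g x).
Proof.
move=> oU; elim: k f g => [|k IH] f g.
  by move=> [fc _] [gc _]; split=> // x Ux; apply: continuousM; [exact: fc|exact: gc].
move=> Cf Cg; have [fc fd] := Cf; have [gc gd] := Cg; split=> //.
  by move=> x Ux; apply: continuousM; [exact: fc|exact: gc].
move=> i; have [di Di] := fd i; have [ei Ei] := gd i; split=> [x Ux|].
  by apply: derivableM; [exact: di|exact: ei].
apply: sCk_ext (sCkD oU (IH _ _ (sCk_S Cf) Ei) (IH _ _ (sCk_S Cg) Di)) => // x Ux.
by rewrite deriveM//; [exact: di|exact: ei].
Qed.

Lemma sCkN k U f : open U -> sCk k U f -> sCk k U (fun x => - f x).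
Proof.
move=> oU Cf; apply: sCk_ext (sCkM oU (sCk_cst k U (-1)) Cf) => // x _.
by rewrite mulN1r.
Qed.

Lemma sCkV k U f : open U -> (forall x, U x -> f x != 0) -> sCk k U f ->
  sCk k U (fun x => (f x)^-1).
Proof.
move=> oU f0; elim: k => [|k IH].
  by move=> [fc _]; split=> // x Ux; apply: continuousV; [exact: f0|exact: fc].
move=> Cf; have [fc fd] := Cf; split=> //.
  by move=> x Ux; apply: continuousV; [exact: f0|exact: fc].
move=> i; have [di Di] := fd i; split=> [x Ux|].
  by apply: derivableV; [exact: f0|exact: di].
have CV := IH (sCk_S Cf).
apply: sCk_ext (sCkN oU (sCkM oU (sCkM oU CV CV) Di)) => // x Ux.
by rewrite deriveV//; [rewrite expr2 invfM scaleNr|exact: f0|exact: di].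
Qed.

Lemma sCk_sum k U (I : Type) (r : seq I) (P : pred I) (F : I -> 'rV[R]_n -> R) :
  open U -> (forall i, P i -> sCk k U (F i)) ->
  sCk k U (fun x => \sum_(i <- r | P i) F i x).
Proof.
move=> oU CF; elim: r => [|a r IH].
  by apply: sCk_ext (sCk_cst k U 0) => // x _; rewrite big_nil.
case Pa : (P a); last first.
  by apply: sCk_ext IH => // x _; rewrite big_cons Pa.
by apply: sCk_ext (sCkD oU (CF a Pa) IH) => // x _; rewrite big_cons Pa.
Qed.

Lemma sCk_prod k U (I : Type) (r : seq I) (P : pred I) (F : I -> 'rV[R]_n -> R) :
  open U -> (forall i, P i -> sCk k U (F i)) ->
  sCk k U (fun x => \prod_(i <- r | P i) F i x).
Proof.
move=> oU CF; elim: r => [|a r IH].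
  by apply: sCk_ext (sCk_cst k U 1) => // x _; rewrite big_nil.
case Pa : (P a); last first.
  by apply: sCk_ext IH => // x _; rewrite big_cons Pa.
by apply: sCk_ext (sCkM oU (CF a Pa) IH) => // x _; rewrite big_cons Pa.
Qed.

Lemma derivable_coord (x v : 'rV[R]_n) j :
  is_derive x v (fun y : 'rV[R]_n => y 0 j) (v 0 j).
Proof.
have d : derivable (@id 'rV[R]_n) x v by exact: derivable_id.
have := (derivable_mxP id x v).1 d 0 j.
move=> dj; split=> //.
by have := derive_mx d; rewrite derive_id => /matrixP/(_ 0 j) ->; rewrite mxE.
Qed.

Lemma sCk_coord k U j : sCk k U (fun x => x 0 j).
Proof.
case: k => [|k]; split=> //; try by move=> x _; exact: coord_continuous.
move=> i; split=> [x _|]; first by case: (derivable_coord x (delta_mx 0 i) j).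
rewrite (_ : 'D__ _ = fun=> (delta_mx 0 i : 'rV[R]_n) 0 j); first exact: sCk_cst.
by apply/funext => x; case: (derivable_coord x (delta_mx 0 i) j).
Qed.

End Fixedn.
End ScalarCk.

(** The epsilon-delta form of differentiability, with the derivative identified by its uniqueness.
    It serves both for functions with continuous partials and for the inverse function. *)
Lemma differentiable_estimate (R : numFieldType) (V W : normedModType R)
    (f : V -> W) (df : {linear V -> W}) (x : V) :
  continuous df ->
  (forall e, 0 < e -> exists2 d, 0 < d &
     forall h, `|h| < d -> `|f (x + h) - f x - df h| <= e * `|h|) ->
  differentiable f x /\ 'd f x = df :> (V -> W).
Proof.
move=> cdf H.
have dE : f \o shift x = cst (f x) + df +o_ 0 id.
  apply/eqaddoP => e /H[d d0 {}H].
  apply/nbhs_ballP; exists d => //= h; rewrite -ball_normE /ball_/= sub0r normrN.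
  move=> /H; change (`|f (x + h) - f x - df h| <= e * `|h| ->
    `|f (h + x) - (f x + df h)| <= e * `|h|).
  by rewrite opprD addrA [h + x]addrC.
have dd := diff_unique cdf dE.
by split=> //; apply/diff_locallyP; rewrite dd.
Qed.

(** * Total differentiability from continuous partial derivatives *)

Section Diff.
Context (R : realType) (n : nat).
Implicit Types (U V : set 'rV[R]_n) (f : 'rV[R]_n -> R) (x h v : 'rV[R]_n).

(** The corners of the staircase from 0 to [h] that changes one coordinate at a time. *)
Let trunc (k : nat) h : 'rV[R]_n := \row_j (if (j < k)%N then h 0 j else 0).

Let truncS (i : 'I_n) h : trunc i.+1 h = trunc i h + h 0 i *: delta_mx 0 i.
Proof.
apply/rowP => j; rewrite !mxE eqxx/= eq_sym -val_eqE/= ltnS leq_eqVlt.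
case: eqVneq => /= ji; first by rewrite (val_inj ji) ltnn mulr1 add0r.
by rewrite mulr0 addr0.
Qed.

(** The increment of [f] telescopes along the staircase [trunc]. By the mean value theorem each step
    is [h 0 i] times a partial derivative at a point near [x], where continuity compares it with its
    value at [x]. *)
Lemma grad_estimate U f x : open U -> sCk 1 U f -> U x ->
  forall e, 0 < e -> exists2 d, 0 < d & forall h, `|h| < d ->
  `|f (x + h) - f x - \sum_i h 0 i * 'D_(delta_mx 0 i) f x| <= e * `|h|.
Proof.
move=> oU [fc fd] Ux e e0.
(* There are [n] steps, each with error at most [e' * |h|]; dividing by [n + 1] also covers
   [n = 0]. *)
pose e' := e / n.+1%:R.
have e'0 : 0 < e' by rewrite divr_gt0.
have near1 : \forall y \near x, U y /\ forall i : 'I_n,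
    `|'D_(delta_mx 0 i) f y - 'D_(delta_mx 0 i) f x| <= e'.
  have nU : nbhs x U by exact: open_nbhs_nbhs.
  have /(filterI nU) : \forall y \near x, forall i : 'I_n,
    `|'D_(delta_mx 0 i) f y - 'D_(delta_mx 0 i) f x| <= e' ; last by [].
  apply: (@filter_forall _ 'I_n _ (nbhs x)) => i; have [_ [/(_ x Ux) cD _]] := fd i.
  move/cvgrPdist_le : cD => /(_ _ e'0); apply: filterS => y.
  by rewrite distrC.
have [d d0 dP] : exists2 d, 0 < d & forall y, `|y - x| < d -> U y /\ forall i : 'I_n,
    `|'D_(delta_mx 0 i) f y - 'D_(delta_mx 0 i) f x| <= e'.
  have /nbhs_ballP[d d0 H] := near1.
  by exists d => // y yx; apply: H; rewrite -ball_normE /ball_ /= distrC.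
exists d => // h hd.
have t0 : trunc 0 h = 0 by apply/rowP => j; rewrite !mxE.
have tn : trunc n h = h by apply/rowP => j; rewrite !mxE ltn_ord.
have -> : f (x + h) - f x = \sum_(i < n) (f (x + trunc i.+1 h) - f (x + trunc i h)).
  rewrite -(big_mkord xpredT (fun i => f (x + trunc i.+1 h) - f (x + trunc i h))).
  by rewrite telescope_sumr // tn t0 addr0.
rewrite -sumrB; apply: le_trans (ler_norm_sum _ _ _) _.
have tle (i : 'I_n) (t : R) : `|t| <= `|h 0 i| ->
    `|x + trunc i h + t *: delta_mx 0 i - x| < d.
  move=> th; apply: le_lt_trans hd; rewrite addrC addrA addKr.
  apply: rV_norm_le => // j; rewrite !mxE eqxx/= eq_sym -val_eqE/=.
  case: ltngtP => /= ji.
  - by rewrite mulr0 addr0; exact: rV_norm_coord.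
  - by rewrite mulr0 addr0 normr0.
  - by rewrite add0r mulr1 (le_trans th)//; exact: rV_norm_coord.
apply: (@le_trans _ _ (\sum_(i < n) e' * `|h|)).
  apply: ler_sum => i _.
  have [|c ch] := @MVT_line _ _ f (x + trunc i h) (delta_mx 0 i) (h 0 i).
    by move=> t /between0_norm/tle /dP[Uy _]; have [+ _] := fd i; exact.
  move/between0_norm in ch.
  rewrite truncS addrA => ->.
  rewrite -mulrBr normrM mulrC; apply: ler_pM => //.
    by have [_] := dP _ (tle _ _ ch); exact.
  exact: rV_norm_coord.
rewrite sumr_const card_ord -mulrnAl; apply: ler_wpM2r => //.
rewrite /e' -mulr_natr mulrAC ler_pdivrMr//.
by apply: ler_wpM2l; [exact: ltW|rewrite ler_nat].
Qed.

Lemma sCk_diff U f x : open U -> sCk 1 U f -> U x ->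
  differentiable f x /\
  forall v, 'd f x v = \sum_i v 0 i * 'D_(delta_mx 0 i) f x.
Proof.
move=> oU Cf Ux.
pose d v := \sum_i v 0 i * 'D_(delta_mx 0 i) f x.
have lind : linear d.
  move=> a u v; rewrite /d scaler_sumr -big_split/=; apply: eq_bigr => i _.
  by rewrite !mxE mulrDl -mulrA.
pose dM := GRing.isLinear.Build _ _ _ _ _ lind.
pose dL : {linear 'rV[R]_n -> R} := HB.pack d dM.
have cd : continuous dL.
  have dC : sCk 0 [set: 'rV[R]_n] d.
    apply: sCk_sum => [|i _]; first exact: openT.
    by apply: sCkM; [exact: openT|exact: sCk_coord|exact: sCk_cst].
  by move=> v; apply: (sCk_cont dC).
suff [fx dd] : differentiable f x /\ 'd f x = dL :> ('rV[R]_n -> R).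
  by split=> // v; rewrite dd.
apply: differentiable_estimate => // e /(grad_estimate oU Cf Ux)[r r0 H].
by exists r.
Qed.

End Diff.

Section Vector.
Context (R : realType) (n m : nat).
Implicit Types (U V : set 'rV[R]_n) (f : 'rV[R]_n -> 'rV[R]_m).

Lemma continuous_coordP f (x : 'rV[R]_n) :
  {for x, continuous f} <-> forall j, {for x, continuous (fun y => f y 0 j)}.
Proof.
split=> [fc j|fc].
  apply: (@continuous_comp _ _ _ f (fun y : 'rV[R]_m => y 0 j)); first exact: fc.
  exact: coord_continuous.
rewrite /prop_for /continuous_at => A /nbhs_ballP[e e0 eA].
have : nbhs x [set y | forall j, ball (f x 0 j) e (f y 0 j)].
  apply: (@filter_forall _ 'I_m _ (nbhs x)) => j.
  by apply: (fc j); exact: nbhsx_ballx.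
apply: filterS => y fy; apply: eA; split=> // i j.
by rewrite (ord1 i); exact: fy.
Qed.

Lemma Ck_coordP k U f : open U ->
  Ck k U f <-> forall j, sCk k U (fun x => f x 0 j).
Proof.
move=> oU; elim: k f => [|k IH] f.
  split=> [[fc _] j|H].
    by split=> // x Ux; move: j; apply/continuous_coordP; exact: fc.
  split=> // x Ux; apply/continuous_coordP => j.
  exact: (sCk_cont (H j)).
split=> [[fc fd] j|H].
  split=> [x Ux|i]; first by move: j; apply/continuous_coordP; exact: fc.
  have [di Di] := fd i; split=> [x Ux|].
    by have := (derivable_mxP f x (delta_mx 0 i)).1 (di x Ux) 0 j.
  apply: sCk_ext ((IH _).1 Di j) => // x Ux.
  by rewrite derive_mx ?mxE//; exact: di.
split=> [x Ux|i].
  by apply/continuous_coordP => j; exact: (sCk_cont (H j)).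
have dfx x : U x -> derivable f x (delta_mx 0 i).
  move=> Ux; apply/derivable_mxP => a j; rewrite (ord1 a).
  by have [_ /(_ i)[+ _]] := H j; exact.
split=> //; apply/IH => j; have [_ /(_ i)[_]] := H j.
apply: sCk_ext => // x Ux.
by rewrite derive_mx ?mxE//; exact: dfx.
Qed.

Lemma differentiable_rV f (x : 'rV[R]_n) :
  (forall j, differentiable (fun y => f y 0 j) x) -> differentiable f x.
Proof.
move=> fd.
have -> : f = \sum_(j < m) (fun y => f y 0 j *: delta_mx 0 j).
  by apply/funext => y; rewrite fct_sumE; exact: row_sum_delta.
by apply: differentiable_sum => j; exact: differentiableZl.
Qed.

Lemma Ck1_differentiable U f x : open U -> Ck 1 U f -> U x -> differentiable f x.
Proof.
move=> oU /(Ck_coordP _ _ oU) Cf Ux; apply: differentiable_rV => j.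
by have [] := sCk_diff oU (Cf j) Ux.
Qed.

Lemma smooth_onP U f : open U ->
  smooth_on U f <-> forall j k, sCk k U (fun x => f x 0 j).
Proof.
move=> oU; split=> [Sf j k|H k]; first exact: (Ck_coordP k f oU).1 (Sf k) j.
by apply/Ck_coordP.
Qed.

End Vector.

(** The chain rule writes a partial derivative of [f \o g] as a sum of products of partials of [g]
    with partials of [f] composed with [g]. These composites fall under the induction hypothesis one
    order lower. *)
Lemma sCk_comp (R : realType) (n m k : nat) (U : set 'rV[R]_n) (V : set 'rV[R]_m)
    (f : 'rV[R]_n -> R) (g : 'rV[R]_m -> 'rV[R]_n) :
  open U -> open V -> (forall y, V y -> U (g y)) ->
  sCk k U f -> (forall j, sCk k V (fun y => g y 0 j)) -> sCk k V (f \o g).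
Proof.
move=> oU oV VU; elim: k f => [|k IH] f Cf Cg.
  split=> // y Vy; apply: continuous_comp; last exact: (sCk_cont Cf (VU _ Vy)).
  by apply/continuous_coordP => j; exact: (sCk_cont (Cg j)).
split=> [y Vy|i].
  apply: continuous_comp; last exact: (sCk_cont Cf (VU _ Vy)).
  by apply/continuous_coordP => j; exact: (sCk_cont (Cg j)).
have weak1 p (W : set 'rV[R]_p) h : sCk k.+1 W h -> sCk 1 W h.
  by elim: (k) => // k' IHk /sCk_S.
have dg y : V y -> differentiable g y.
  move=> Vy; apply: differentiable_rV => j.
  by have [] := sCk_diff oV (weak1 _ _ _ (Cg j)) Vy.
have df y : V y -> differentiable f (g y).
  by move=> Vy; have [] := sCk_diff oU (weak1 _ _ _ Cf) (VU _ Vy).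
split=> [y Vy|].
  by apply: diff_derivable; apply: differentiable_comp; [exact: dg|exact: df].
have E y : V y -> \sum_j ('D_(delta_mx 0 i) (fun y => g y 0 j) y *
    ('D_(delta_mx 0 j) f \o g) y) = 'D_(delta_mx 0 i) (f \o g) y.
  move=> Vy; have Dg := dg y Vy; have Df := df y Vy.
  rewrite deriveE; last exact: differentiable_comp.
  rewrite diff_comp//= (sCk_diff oU (weak1 _ _ _ Cf) (VU _ Vy)).2.
  apply: eq_bigr => j _; congr (_ * _).
  by rewrite -deriveE// derive_mx ?mxE//; exact: diff_derivable.
apply: (sCk_ext oV E); apply: sCk_sum => // j _; apply: sCkM => //.
  by have [_ /(_ i)[]] := Cg j.
apply: IH; last by move=> j'; exact: sCk_S.
by have [_ /(_ j)[]] := Cf.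
Qed.

(** * Closure properties of smooth maps between open sets *)

Section Smooth.
Context (R : realType).

Lemma smooth_continuous n m (U : set 'rV[R]_n) (f : 'rV[R]_n -> 'rV[R]_m) x :
  smooth_on U f -> U x -> {for x, continuous f}.
Proof. by move=> /(_ 0) [+ _]; exact. Qed.

Lemma smooth_preimage n m (U : set 'rV[R]_n) (f : 'rV[R]_n -> 'rV[R]_m) O :
  open U -> smooth_on U f -> open O -> open (U `&` f @^-1` O).
Proof.
move=> oU sf oO; apply: (continuous_inP _ oU).1 => // x /set_mem Ux.
exact: (smooth_continuous sf).
Qed.

Lemma smooth_sub n m (U V : set 'rV[R]_n) (f : 'rV[R]_n -> 'rV[R]_m) :
  open U -> open V -> V `<=` U -> smooth_on U f -> smooth_on V f.
Proof.
move=> oU oV VU /(smooth_onP _ oU) sf; apply/smooth_onP => // j k.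
exact: sCk_sub (sf j k).
Qed.

Lemma smooth_comp n m p (U : set 'rV[R]_n) (V : set 'rV[R]_m)
    (f : 'rV[R]_n -> 'rV[R]_p) (g : 'rV[R]_m -> 'rV[R]_n) :
  open U -> open V -> (forall y, V y -> U (g y)) ->
  smooth_on U f -> smooth_on V g -> smooth_on V (f \o g).
Proof.
move=> oU oV VU /(smooth_onP _ oU) sf /(smooth_onP _ oV) sg.
apply/smooth_onP => // j k.
by apply: (sCk_comp oU oV VU (sf j k)) => i; exact: sg.
Qed.

Lemma smooth_cst n m (U : set 'rV[R]_n) (c : 'rV[R]_m) :
  open U -> smooth_on U (fun=> c).
Proof. by move=> oU; apply/smooth_onP => // j k; exact: sCk_cst. Qed.

Lemma smooth_id n (U : set 'rV[R]_n) : open U -> smooth_on U id.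
Proof. by move=> oU; apply/smooth_onP => // j k; exact: sCk_coord. Qed.

Lemma smooth_mulmx n m p (U : set 'rV[R]_n) (f : 'rV[R]_n -> 'rV[R]_m)
    (A : 'M[R]_(m, p)) :
  open U -> smooth_on U f -> smooth_on U (fun x => f x *m A).
Proof.
move=> oU /(smooth_onP _ oU) sf; apply/smooth_onP => // j k.
apply: (@sCk_ext _ _ _ _ (fun x => \sum_i f x 0 i * A i j)) => //.
  by move=> x _; rewrite mxE.
by apply: sCk_sum => // i _; apply: sCkM => //; exact: sCk_cst.
Qed.

Lemma smooth_row_mx n m p (U : set 'rV[R]_n) (f : 'rV[R]_n -> 'rV[R]_m)
    (g : 'rV[R]_n -> 'rV[R]_p) :
  open U -> smooth_on U f -> smooth_on U g ->
  smooth_on U (fun x => row_mx (f x) (g x)).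
Proof.
move=> oU /(smooth_onP _ oU) sf /(smooth_onP _ oU) sg; apply/smooth_onP => // j k.
case: (splitP j) => i ji.
  apply: (sCk_ext oU _ (sf i k)) => x _.
  by rewrite (_ : j = lshift p i) ?row_mxEl//; exact: val_inj.
apply: (sCk_ext oU _ (sg i k)) => x _.
by rewrite (_ : j = rshift m i) ?row_mxEr//; exact: val_inj.
Qed.

Lemma smooth_lsubmx n m p (U : set 'rV[R]_n) (f : 'rV[R]_n -> 'rV[R]_(m + p)) :
  open U -> smooth_on U f -> smooth_on U (fun x => lsubmx (f x)).
Proof.
move=> oU /(smooth_onP _ oU) sf; apply/smooth_onP => // j k.
by apply: sCk_ext (sf (lshift p j) k) => // x _; rewrite mxE.
Qed.

Lemma smooth_rsubmx n m p (U : set 'rV[R]_n) (f : 'rV[R]_n -> 'rV[R]_(m + p)) :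
  open U -> smooth_on U f -> smooth_on U (fun x => rsubmx (f x)).
Proof.
move=> oU /(smooth_onP _ oU) sf; apply/smooth_onP => // j k.
by apply: sCk_ext (sf (rshift m j) k) => // x _; rewrite mxE.
Qed.

Lemma smooth_differentiable n m (U : set 'rV[R]_n) (f : 'rV[R]_n -> 'rV[R]_m) x :
  open U -> smooth_on U f -> U x -> differentiable f x.
Proof. by move=> oU sf; apply: Ck1_differentiable (sf 1). Qed.

Lemma sCk_det n m k (U : set 'rV[R]_n) (M : 'rV[R]_n -> 'M[R]_m) :
  open U -> (forall i j, sCk k U (fun x => M x i j)) ->
  sCk k U (fun x => \det (M x)).
Proof.
move=> oU CM; rewrite /determinant; apply: sCk_sum => // s _.
by apply: sCkM => //; [exact: sCk_cst|apply: sCk_prod].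
Qed.

(** By Cramer's rule the entries of the inverse are cofactors divided by the determinant. *)
Lemma sCk_invmx n m k (U : set 'rV[R]_n) (M : 'rV[R]_n -> 'M[R]_m) :
  open U -> (forall x, U x -> M x \in unitmx) ->
  (forall i j, sCk k U (fun x => M x i j)) ->
  forall i j, sCk k U (fun x => invmx (M x) i j).
Proof.
move=> oU uM CM i j.
apply: (@sCk_ext _ _ _ _ (fun x => (\det (M x))^-1 * cofactor (M x) j i)) => //.
  by move=> x Ux; rewrite /invmx (uM _ Ux) !mxE.
apply: sCkM => //.
  apply: sCkV => //; last exact: sCk_det.
  by move=> x /uM; rewrite unitmxE unitfE.
rewrite /cofactor; apply: sCkM => //; first exact: sCk_cst.
apply: sCk_det => // a b.
by apply: sCk_ext (CM (lift j a) (lift i b)) => // x _; rewrite !mxE.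
Qed.

End Smooth.

(** * The inverse function theorem *)

(** Supplies the complete normed structure on row vectors for the Banach fixed point theorem
    below. *)
HB.instance Definition _ (R : realType) n := Complete.on 'rV[R]_n.

Lemma diff_estimate (R : numFieldType) (V W : normedModType R)
    (f : V -> W) (x : V) : differentiable f x ->
  forall e, 0 < e -> exists2 d, 0 < d &
     forall h, `|h| < d -> `|f (x + h) - f x - 'd f x h| <= e * `|h|.
Proof.
move=> /diff_locally dE e e0.
have /eqaddoP/(_ e e0)/nbhs_ballP[d d0 H] := dE.
exists d => // h hd.
have {}H := H h; rewrite -ball_normE /ball_/= sub0r normrN in H.
have {H} := H hd; change (`|f (h + x) - (f x + 'd f x h)| <= e * `|h| ->
  `|f (x + h) - f x - 'd f x h| <= e * `|h|).
by rewrite opprD addrA [h + x]addrC.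
Qed.

Lemma closed_ball_contraction_fixpoint (R : realType) n (z : 'rV[R]_n) (r q : R)
    (T : 'rV[R]_n -> 'rV[R]_n) : 0 <= r -> 0 <= q -> q < 1 ->
  (forall x, `|x - z| <= r -> `|T x - z| <= r) ->
  (forall x y, `|x - z| <= r -> `|y - z| <= r -> `|T x - T y| <= q * `|x - y|) ->
  exists2 p, `|p - z| <= r & T p = p.
Proof.
move=> r0 q0 q1 TB Tq; pose B := [set x : 'rV[R]_n | `|x - z| <= r].
have fB : {homo T : x / B x >-> B x} by exact: TB.
have cB : closed B.
  rewrite (_ : B = (fun x : 'rV[R]_n => `|x - z|) @^-1` [set t | t <= r])//.
  apply: closed_comp; last exact: closed_le.
  move=> x _; apply: continuous_comp; last exact: norm_continuous.
  by apply: continuousB => //; exact: cst_continuous.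
have [||p Bp Tp] := @banach_fixed_point R 'rV[R]_n B (mkfun_fun fB) _ cB.
- exists (NngNum q0); split=> // -[x y] [/= Bx By]; exact: Tq.
- by exists z; rewrite /B/= subrr normr0.
- by exists p.
Qed.

Section InverseFunction.
Context (R : realType) (n : nat).
Implicit Types (U V O : set 'rV[R]_n) (f g : 'rV[R]_n -> 'rV[R]_n).

(** The transpose of the usual Jacobian: vectors are rows, so the differential acts by
    multiplication on the right. *)
Definition partials f (x : 'rV[R]_n) : 'M[R]_n :=
  \matrix_(i, j) 'D_(delta_mx 0 i) (fun y => f y 0 j) x.

Lemma sCk_partials k U f i j : open U -> smooth_on U f ->
  sCk k U (fun x => partials f x i j).
Proof.
move=> oU /(smooth_onP _ oU)/(_ j k.+1)[_ /(_ i)[_]].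
by apply: sCk_ext => // x _; rewrite mxE.
Qed.

Lemma diff_partials U f x v : open U -> smooth_on U f -> U x ->
  'd f x v = v *m partials f x.
Proof.
move=> oU sf Ux; have df := smooth_differentiable oU sf Ux.
have {}sf := (smooth_onP _ oU).1 sf.
rewrite -deriveE// derive_mx; last exact: diff_derivable.
apply/rowP => j; rewrite !mxE.
have [dj dE] := sCk_diff oU (sf j 1) Ux.
by rewrite deriveE// dE; apply: eq_bigr => i _; rewrite mxE.
Qed.

(** Near [z] the map [phi = id - f] is a contraction, so [f x = y] is solved as the fixed point of
    [x |-> y + phi x]. Normalising the Jacobian at [z] to the identity loses nothing, since a linear
    change of coordinates achieves it where the lemma is applied. *)
Lemma inverse_function_id U f z : open U -> smooth_on U f -> U z ->
  partials f z = 1%:M ->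
  exists O V g, [/\ open O /\ O z, O `<=` U, open V, smooth_on V g &
    (forall x, O x -> V (f x) /\ g (f x) = x) /\
    (forall y, V y -> O (g y) /\ f (g y) = y)].
Proof.
move=> oU sf Uz Jz.
have cp i j : {for z, continuous (fun x => partials f x i j)}.
  exact: (sCk_cont (sCk_partials 0 i j oU sf)).
have uz : \det (partials f z) != 0 by rewrite Jz det1 oner_neq0.
(* A coordinate of [phi x - phi y] is bounded by a sum of [n] terms, each at most [e * |x - y|];
   this choice makes the Lipschitz constant at most 1/2. *)
pose e : R := (2 * n.+1%:R)^-1.
have e0 : 0 < e by rewrite invr_gt0 mulr_gt0.
(* a ball on which [f - id] is a contraction and the Jacobian is invertible *)
have [r r0 rP] : exists2 r, 0 < r & forall x, `|x - z| < r ->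
    [/\ U x, \det (partials f x) != 0 &
     forall ij : 'I_n * 'I_n,
       `|partials f x ij.1 ij.2 - (ij.1 == ij.2)%:R| <= e].
  have nU : nbhs z U by exact: open_nbhs_nbhs.
  pose J := [set x | forall ij : 'I_n * 'I_n,
    `|partials f x ij.1 ij.2 - (ij.1 == ij.2)%:R| <= e].
  have nJ : nbhs z J.
    apply: (@filter_forall _ ('I_n * 'I_n)%type _ (nbhs z)) => -[i j] /=.
    have /cvgrPdist_le/(_ _ e0) := cp i j; apply: filterS => x.
    by rewrite Jz mxE distrC.
  pose D := [set x | \det (partials f x) != 0].
  have nD : nbhs z D.
    have cd : {for z, continuous (fun x => \det (partials f x))}.
      apply: (@sCk_cont R n 0 U) => //; apply: sCk_det => // i j.
      exact: sCk_partials.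
    have := open_nbhs_nbhs (conj (@open_neq R 0) uz).
    by move=> /cd.
  have /nbhs_ballP[r r0 H] : nbhs z (U `&` (D `&` J)).
    by apply: filterI => //; apply: filterI.
  exists r => // x xz; suff /H[? []] : ball z r x by [].
  by rewrite -ball_normE /ball_/= distrC.
have oB : open [set x | `|x - z| < r].
  rewrite (_ : [set _ | _] = ball z r); first exact: ball_open.
  by apply/seteqP; split => x; rewrite -ball_normE /ball_/= distrC.
pose phi x := x - f x.
have phi_lip x y : `|x - z| < r -> `|y - z| < r ->
    `|phi x - phi y| <= 2^-1 * `|x - y|.
  move=> xr yr; apply: rV_norm_le => [|j]; first by rewrite mulr_ge0.
  pose F u := f u 0 j - u 0 j.
  have CF : sCk 1 U F.
    apply: sCkD => //; first exact: (smooth_onP _ oU).1 sf j 1.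
    by apply: sCkN => //; exact: sCk_coord.
  have segr (t : R) : 0 <= t <= 1 -> `|y + t *: (x - y) - z| < r.
    move=> /andP[t0 t1].
    rewrite (_ : y + _ - z = t *: (x - z) + (1 - t) *: (y - z)); last first.
      by apply/rowP => i; rewrite !mxE; ring.
    apply: le_lt_trans (ler_normD _ _) _; rewrite !normrZ !ger0_norm ?subr_ge0//.
    apply: (@le_lt_trans _ _ (Num.max `|x - z| `|y - z|)); last by rewrite gt_max xr.
    have xM : `|x - z| <= Num.max `|x - z| `|y - z| by rewrite le_max lexx.
    have yM : `|y - z| <= Num.max `|x - z| `|y - z| by rewrite le_max lexx orbT.
    by nra.
  have segm (t : R) : Num.min 0 1 <= t <= Num.max 0 1 -> `|y + t *: (x - y) - z| < r.
    by move=> t01; apply: segr; move: t01; rewrite min_l ?max_r.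
  have segU (t : R) : Num.min 0 1 <= t <= Num.max 0 1 -> U (y + t *: (x - y)).
    by move=> /segm/rP[].
  have [t t1] := @MVT_line R n F y (x - y) 1
    (fun t t1 => diff_derivable (sCk_diff oU CF (segU t t1)).1).
  rewrite scale1r mul1r [y + _]addrC subrK => tE.
  rewrite (_ : _ 0 j = F y - F x); last by rewrite /phi /F !mxE; ring.
  rewrite distrC tE; have Ut := segU t t1; have [df dE] := sCk_diff oU CF Ut.
  rewrite deriveE// dE; apply: le_trans (ler_norm_sum _ _ _) _.
  apply: (@le_trans _ _ (\sum_(i < n) `|x - y| * e)); last first.
    rewrite sumr_const card_ord -mulrnAr mulrC ler_wpM2r//.
    rewrite /e invfM -mulr_natr -mulrA ler_piMr//.
    by rewrite ler_pdivrMl// mulr1 ler_nat.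
  apply: ler_sum => i _; rewrite normrM ler_pM//; first exact: rV_norm_coord.
  have [_ _ /(_ (i, j))/=] := rP _ (segm t t1).
  rewrite mxE.
  have dfj : derivable (fun u => f u 0 j) (y + t *: (x - y)) (delta_mx 0 i).
    exact/diff_derivable/(sCk_diff oU ((smooth_onP _ oU).1 sf j 1) Ut).1.
  have [dcj cjE] := derivable_coord (y + t *: (x - y)) (delta_mx 0 i) j.
  rewrite (_ : F = (fun u => f u 0 j) - (fun u : 'rV[R]_n => u 0 j))//.
  by rewrite deriveB// cjE mxE eqxx/= [j == i]eq_sym.
have f_inj x y : `|x - z| < r -> `|y - z| < r -> `|x - y| <= 2 * `|f x - f y|.
  move=> xr yr; have := phi_lip _ _ xr yr.
  have : `|x - y| <= `|f x - f y| + `|phi x - phi y|.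
    by apply: le_trans (ler_normD _ _); rewrite /phi le_eqVlt; apply/orP; left;
      apply/eqP; congr `|_|; apply/rowP => i; rewrite !mxE; ring.
  by move=> *; lra.
(* The fixed point is sought in the closed ball of radius [s], inside the open ball of radius [r]. A
   point [y] within [s / 2] of [f z] contributes [s / 2], and the contraction another [s / 2], so
   this closed ball is preserved. *)
pose s := r / 2.
have s0 : 0 < s by rewrite divr_gt0.
have sr : s < r by rewrite /s; lra.
pose V := [set y | `|y - f z| < s / 2].
have solve y : V y -> exists x, `|x - z| < r /\ f x = y.
  move=> Vy.
  have [||||x y' xs y's|p ps Tp] :=
      @closed_ball_contraction_fixpoint R n z s 2^-1 (fun x => y + phi x).
  - exact: ltW.
  - by [].
  - by rewrite invf_lt1// ltr1n.
  - move=> x xs.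
    rewrite (_ : y + phi x - z = (y - f z) + (phi x - phi z)); last first.
      by rewrite /phi; apply/rowP => i; rewrite !mxE; ring.
    apply: le_trans (ler_normD _ _) _.
    have := phi_lip x z (le_lt_trans xs sr).
    rewrite subrr normr0 => /(_ r0) H; have {}Vy : `|y - f z| < s / 2 := Vy.
    by lra.
  - rewrite opprD addrACA subrr add0r.
    by apply: phi_lip; apply: le_lt_trans sr.
  exists p; split; first exact: le_lt_trans sr.
  apply/eqP; rewrite -subr_eq0; apply/eqP/rowP => i.
  by move/rowP/(_ i): Tp; rewrite /phi !mxE => H; lra.
have /choice[g gP] : forall y, exists x, V y -> `|x - z| < r /\ f x = y.
  by move=> y; have [/solve[x]|nVy] := pselect (V y); [exists x|exists 0].
pose B := [set x | `|x - z| < r].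
have BU : B `<=` U by move=> x /rP[].
have sfB : smooth_on B f by exact: smooth_sub sf.
have oV : open V.
  rewrite (_ : V = ball (f z) (s / 2)); first exact: ball_open.
  by apply/seteqP; split => x; rewrite -ball_normE /ball_/= distrC.
have gf x : B x -> V (f x) -> g (f x) = x.
  move=> Bx /gP[gr fE]; apply/eqP; rewrite -subr_eq0 -normr_le0.
  by have := f_inj _ _ gr Bx; rewrite fE subrr normr0 mulr0.
have g_lip y y' : V y -> V y' -> `|g y - g y'| <= 2 * `|y - y'|.
  move=> /gP[gr fE] /gP[gr' fE'].
  by have := f_inj _ _ gr gr'; rewrite fE fE'.
have dg y : V y -> differentiable g y /\
    forall v, 'd g y v = v *m invmx (partials f (g y)).
  move=> Vy; have [gr fE] := gP y Vy.
  have uJ : partials f (g y) \in unitmx.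
    by have [_ + _] := rP _ gr; rewrite unitmxE unitfE.
  have cJ : continuous (mulmxr (invmx (partials f (g y))) : 'rV[R]_n -> 'rV[R]_n).
    move=> v; apply: (smooth_continuous (U := setT)) => //.
    by apply: smooth_mulmx (smooth_id _); exact: openT.
  have [M M0 MP] := linear_lipschitz cJ.
  suff [dgy dE] : differentiable g y /\
      'd g y = mulmxr (invmx (partials f (g y))) :> ('rV[R]_n -> 'rV[R]_n).
    by split=> // v; rewrite dE.
  apply: differentiable_estimate => // a a0.
  (* [M] bounds the inverse Jacobian at [g y], and 2 is the Lipschitz constant of [g]; both factors
     appear when the error of [f] is carried over to [g]. *)
  have a'0 : 0 < a / (2 * M) by rewrite divr_gt0// mulr_gt0.
  have [d' d'0 d'P] := diff_estimate (smooth_differentiable oU sf (BU _ gr)) a'0.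
  have [d d0 dP] := open_ballP oV Vy.
  (* The first bound keeps [y + h] in [V]; the second, by [g_lip], keeps the increment of [g] below
     [d']. *)
  exists (Num.min d (d' / 2)); first by rewrite lt_min d0 divr_gt0.
  move=> h; rewrite lt_min => /andP[hd hd'].
  have Vyh : V (y + h) by apply: dP; rewrite addrC addKr.
  have [gr' fE'] := gP _ Vyh.
  set k := g (y + h) - g y.
  have kh : `|k| <= 2 * `|h|.
    by have := g_lip _ _ Vyh Vy; rewrite [y + h - y]addrAC subrr add0r.
  have kd' : `|k| < d' by lra.
  have kE : g y + k = g (y + h) by rewrite /k addrC subrK.
  have := d'P _ kd'; rewrite kE fE' fE [y + h - y]addrAC subrr add0r.
  rewrite (diff_partials _ oU sf (BU _ gr)) => hk.
  rewrite (_ : k - _ = mulmxr (invmx (partials f (g y)))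
      (- (h - k *m partials f (g y)))); last first.
    by rewrite /= mulNmx mulmxBl -mulmxA mulmxV// mulmx1 opprB.
  apply: le_trans (MP _) _; rewrite normrN.
  apply: (@le_trans _ _ (M * (a / (2 * M) * (2 * `|h|)))).
    rewrite ler_pM2l//; apply: le_trans hk _.
    by rewrite ler_pM2l.
  rewrite (_ : M * _ = a * `|h|)//; field.
  by rewrite gt_eqF.
exists (B `&` f @^-1` V), V, g; split=> //.
- split; first exact: smooth_preimage.
  by split; rewrite /B/V/= subrr normr0// divr_gt0.
- by move=> x [/BU].
(* Bootstrapping: the partials of [g] are entries of [invmx (partials f)] composed with [g], so [g]
   of class C^k gives partials of class C^k. *)
- apply/smooth_onP => // j k; elim: k j => [|k IH] j.
    split=> // y Vy.
    move: j; apply/continuous_coordP; apply: differentiable_continuous.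
    by have [] := dg y Vy.
  split=> [y Vy|i].
    move: j; apply/continuous_coordP; apply: differentiable_continuous.
    by have [] := dg y Vy.
  split=> [y Vy|].
    by apply: (derivable_mxP g _ _).1; apply: diff_derivable; have [] := dg y Vy.
  have := @sCk_comp R n n k B V (fun x => invmx (partials f x) i j) g oB oV
    (fun y Vy => (gP y Vy).1).
  have CI : sCk k B (fun x => invmx (partials f x) i j).
    apply: sCk_invmx => // [x|a b]; last exact: sCk_partials.
    by move=> /rP[_ + _]; rewrite unitmxE unitfE.
  move=> /(_ CI IH); apply: sCk_ext => // y Vy.
  have [dgy dE] := dg y Vy.
  have := derive_mx (@diff_derivable _ _ _ g y (delta_mx 0 i) dgy).
  by rewrite deriveE// dE -rowE => /rowP/(_ j); rewrite !mxE.
- split=> [x [Bx Vfx]|y Vy]; first by split=> //; exact: gf.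
  by have [gr fE] := gP y Vy; rewrite /= fE.
Qed.

End InverseFunction.

(** * Submersions are projections in suitable coordinates *)

Section NormalForm.
Context (R : realType).

Lemma differentiable_mulmx n m p (f : 'rV[R]_n -> 'rV[R]_m) (B : 'M[R]_(m, p)) x :
  differentiable f x -> differentiable (fun y => f y *m B) x /\
  forall v, 'd (fun y => f y *m B) x v = 'd f x v *m B.
Proof.
move=> df.
have cB : continuous (mulmxr B : 'rV[R]_m -> 'rV[R]_p).
  move=> v; apply: (smooth_continuous (U := setT)) => //.
  by apply: smooth_mulmx (smooth_id _); exact: openT.
have dB y : differentiable (mulmxr B : 'rV[R]_m -> 'rV[R]_p) y.
  exact: linear_differentiable.
have -> : (fun y => f y *m B) = mulmxr B \o f by [].
split=> [|v]; first exact: differentiable_comp.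
by rewrite diff_comp//= diff_lin.
Qed.

(** [C] consists of the last [k] columns of [col_ebase A]; then [row_mx A C] is [col_ebase A] times
    a block diagonal invertible matrix. *)
Lemma complete_unitmx m k (A : 'M[R]_(m + k, m)) : row_full A ->
  exists C : 'M[R]_(m + k, k), row_mx A C \in unitmx.
Proof.
move=> fA; exists (col_ebase A *m col_mx 0 1%:M).
have -> : row_mx A (col_ebase A *m col_mx 0 1%:M) =
    col_ebase A *m block_mx (row_ebase A) 0 0 1%:M.
  rewrite -[X in row_mx X _]mulmx_ebase -mulmxA -mul_mx_row; congr (_ *m _).
  rewrite (eqP fA) pid_mx_col mul_col_mx mul1mx mul0mx.
  by rewrite /block_mx -!block_mxEh.
rewrite unitmx_mul col_ebase_unit/= unitmxE det_ublock det1 mulr1 -unitmxE.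
exact: row_ebase_unit.
Qed.

Lemma surj_row_full n m (f : {linear 'rV[R]_n -> 'rV[R]_m}) :
  set_surj [set: 'rV[R]_n] [set: 'rV[R]_m] f -> row_full (lin1_mx f).
Proof.
move=> surj.
have /choice[u uP] : forall i : 'I_m, exists u : 'rV[R]_n,
    u *m lin1_mx f = delta_mx 0 i.
  move=> i; have [u _ uE] := surj (delta_mx 0 i) I.
  by exists u; rewrite mul_rV_lin1.
apply/row_fullP; exists (\matrix_i u i); apply/row_matrixP => i.
by rewrite row_mul rowK uP -row1.
Qed.

(** Adjoining the linear coordinates [x *m C] to [f] makes the differential at [z] the invertible
    matrix [P]. Multiplying by [invmx P] turns it into the identity, and the inverse function
    theorem applies. *)
Lemma submersion_normal_form m k (W : set 'rV[R]_(m + k))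
    (f : 'rV[R]_(m + k) -> 'rV[R]_m) z :
  open W -> smooth_on W f -> W z ->
  set_surj [set: 'rV[R]_(m + k)] [set: 'rV[R]_m] ('d f z) ->
  exists (O V : set 'rV[R]_(m + k)) (e h : 'rV[R]_(m + k) -> 'rV[R]_(m + k)),
  [/\ open O /\ O z, O `<=` W, open V,
    smooth_on O e /\ smooth_on V h &
    [/\ forall x, O x -> V (e x) /\ h (e x) = x,
        forall u, V u -> O (h u) /\ e (h u) = u &
        forall x, O x -> lsubmx (e x) = f x]].
Proof.
move=> oW sf Wz surj; have df := smooth_differentiable oW sf Wz.
pose A := lin1_mx ('d f z).
have dA v : 'd f z v = v *m A by rewrite mul_rV_lin1.
have fA : row_full A by exact: surj_row_full.
have [C uP] := complete_unitmx fA.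
set P := row_mx A C in uP.
pose e x := row_mx (f x) (x *m C).
pose F x := e x *m invmx P.
have se : smooth_on W e.
  by apply: smooth_row_mx => //; apply: smooth_mulmx => //; exact: smooth_id.
have sF : smooth_on W F by exact: smooth_mulmx.
have JF : partials F z = 1%:M.
  apply/row_matrixP => i; rewrite !rowE mulmx1 -(diff_partials _ oW sF Wz).
  have [_ ->] := differentiable_mulmx (invmx P) (smooth_differentiable oW se Wz).
  rewrite (_ : 'd e z _ = delta_mx 0 i *m P); last first.
    (* As a sum of maps followed by constant matrices, [e] has a differential given by
       [differentiable_mulmx]. *)
    have eE : e = (fun x => f x *m row_mx 1%:M 0) + (fun x => x *m row_mx 0 C).
      apply/funext => x; rewrite /e -[RHS]/(f x *m row_mx 1%:M 0 + x *m row_mx 0 C).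
      by rewrite !mul_mx_row mulmx1 !mulmx0 add_row_mx addr0 add0r.
    have [d1 dB1] := differentiable_mulmx (row_mx 1%:M 0 : 'M[R]_(m, m + k)) df.
    have dI : differentiable (@id 'rV[R]_(m + k)) z by [].
    have [d2 dB2] := differentiable_mulmx (row_mx 0 C : 'M[R]_(m + k, m + k)) dI.
    rewrite eE diffD//.
    transitivity ('d f z (delta_mx 0 i) *m row_mx 1%:M 0 +
      'd (@id 'rV[R]_(m + k)) z (delta_mx 0 i) *m row_mx 0 C).
      by rewrite -dB1 -dB2.
    rewrite diff_val dA /P.
    by rewrite !mul_mx_row mulmx1 !mulmx0 add_row_mx addr0 add0r.
  by rewrite -mulmxA mulmxV// mulmx1.
have [N [V [g [[oN Nz] NW oV sg [gF Fg]]]]] := inverse_function_id oW sF Wz JF.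
pose V' := [set u : 'rV[R]_(m + k) | V (u *m invmx P)].
have smul : smooth_on [set: 'rV[R]_(m + k)] (fun u => u *m invmx P).
  by apply: smooth_mulmx; [exact: openT|exact: smooth_id openT].
have oV' : open V' by have := smooth_preimage openT smul oV; rewrite setTI.
exists N, V', e, (fun u => g (u *m invmx P)); split=> //.
- split; first exact: smooth_sub se.
  by apply: (smooth_comp oV oV' _ sg) => //; apply: smooth_sub smul => //; exact: openT.
- split=> [x Nx|u V'u|x Nx].
  + by have [] := gF x Nx.
  + have [Ng FE] := Fg _ V'u; split=> //.
    have /(congr1 (mulmx^~ P)) := FE.
    by rewrite /F -!mulmxA mulVmx// !mulmx1.
  + by rewrite /e row_mxKl.
Qed.
End NormalForm.

(** * Charts, submersions and fibre products *)

Section Charts.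
Context (R : realType).
Implicit Types (X Y : diffSpace R).

Lemma open_local (T : topologicalType) (S : set T) :
  (forall z, S z -> exists V, [/\ open V, V z & V `<=` S]) -> open S.
Proof.
move=> H; have -> : S = \bigcup_(V in [set V | open V /\ V `<=` S]) V.
  apply/seteqP; split=> [z /H[V [oV Vz VS]]|z [V [_ VS] /VS//]].
  by exists V.
by apply: bigcup_open => V [].
Qed.

Lemma plot_sub X n (U V : set 'rV[R]_n) (p : 'rV[R]_n -> X) :
  plot U p -> open V -> V `<=` U -> plot V p.
Proof. by move=> pp oV VU; exact: (plot_comp pp oV (smooth_id oV) VU). Qed.

Lemma plot_cover X n (U : set 'rV[R]_n) (p : 'rV[R]_n -> X) :
  (forall z, U z -> exists V, [/\ V z, V `<=` U & plot V p]) -> plot U p.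
Proof.
move=> H; have -> : U = \bigcup_(V in [set V | V `<=` U /\ plot V p]) V.
  apply/seteqP; split=> [z /H[V [Vz VU pV]]|z [V [VU _] /VU//]].
  by exists V.
by apply: plot_local => V [].
Qed.

(** Compatibility with the diffeology itself rather than with an atlas: charts can be restricted,
    transported and combined without computing transition maps. *)
Definition dchart X n (c : chart R X n) : Prop :=
  plot (cdom c) (cmap c) /\
  forall m (U : set 'rV[R]_m) p, plot U p -> smooth_in_chart c U p.

Lemma atlas_dchart X n (A : set (chart R X n)) c :
  manifold_atlas A -> A c -> dchart c.
Proof.
move=> [[_ compat] plotA] Ac; split.
  by apply/plotA; split=> [|c' Ac']; [exact: cdom_open|exact: compat].
by move=> m U p /plotA[_]; exact.
Qed.

Lemma atlas_chart X n (A : set (chart R X n)) (x : X) : manifold_atlas A ->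
  exists2 c, A c & (cmap c @` cdom c) x.
Proof.
move=> [[covA _] _]; have : [set: X] x by [].
by rewrite -covA => -[c]; exists c.
Qed.

Lemma smooth_in_chart_plot X n m (c : chart R X n) (U : set 'rV[R]_m) p :
  dchart c -> smooth_in_chart c U p ->
  plot (U `&` p @^-1` (cmap c @` cdom c)) p.
Proof.
move=> [pc _] [oW [f [sf fP]]].
have H := plot_comp pc oW sf (fun z Wz => (fP z Wz).1).
by apply: (plot_ext H) => z /fP[].
Qed.

Lemma dchart_manifold_atlas X n :
  (forall x : X, exists c : chart R X n, dchart c /\ (cmap c @` cdom c) x) ->
  manifold_atlas [set c : chart R X n | dchart c].
Proof.
move=> cov; split; first split.
- apply/seteqP; split=> // x _; have [c [dc xc]] := cov x.
  by exists c.
- by move=> c c' [pc _] [_]; exact.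
- move=> m U p; split=> [pp|[oU sp]].
    by split=> [|c [_]]; [exact: plot_open pp|exact].
  apply: plot_cover => z Uz; have [c [dc zc]] := cov (p z).
  exists (U `&` p @^-1` (cmap c @` cdom c)); split; first by split.
    by move=> ? [].
  by apply: smooth_in_chart_plot; [|exact: sp].
Qed.

Lemma weak_manifoldP X : weak_manifold X <->
  exists n, forall x : X, exists c : chart R X n, dchart c /\ (cmap c @` cdom c) x.
Proof.
split=> [[n [A mA]]|[n cov]]; last first.
  by exists n, [set c | dchart c]; exact: dchart_manifold_atlas.
exists n => x; have [c Ac xc] := atlas_chart x mA.
by exists c; split=> //; exact: atlas_dchart Ac.
Qed.

Lemma dchart_read X n m (c : chart R X n) (U : set 'rV[R]_m) p z :
  dchart c -> plot U p -> U z -> (cmap c @` cdom c) (p z) ->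
  exists W (f : 'rV[R]_m -> 'rV[R]_n), [/\ open W /\ W z, W `<=` U, smooth_on W f &
    forall y, W y -> cdom c (f y) /\ cmap c (f y) = p y].
Proof.
move=> [_ dc] /dc[oW [f [sf fP]]] Uz zc.
by exists (U `&` p @^-1` (cmap c @` cdom c)), f; split=> // y [].
Qed.

Lemma dchart_restrict X n (c : chart R X n) (V : set 'rV[R]_n) :
  dchart c -> open V ->
  exists c' : chart R X n, [/\ dchart c', cdom c' = cdom c `&` V & cmap c' = cmap c].
Proof.
move=> [pc dc] oV.
have oD : open (cdom c `&` V) by apply: openI => //; exact: cdom_open.
have iD : set_inj (cdom c `&` V) (cmap c).
  move=> x y /set_mem[xc _] /set_mem[yc _].
  by apply: cmap_inj; exact: mem_set.
exists (Chart oD iD); split=> //; split=> /=; first exact: (plot_sub pc oD).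
move=> m U p pp; have [oW [f [sf fP]]] := dc m U p pp.
rewrite /smooth_in_chart/=.
set W := U `&` p @^-1` (cmap c @` cdom c) in oW sf fP.
have WE : U `&` p @^-1` (cmap c @` (cdom c `&` V)) = W `&` f @^-1` V.
  apply/seteqP; split=> z.
    move=> [Uz [w [wc Vw] wE]].
    have Wz : W z by split=> //; exists w.
    split=> //; have [fc fE] := fP z Wz.
    suff -> : f @^-1` V = fun z => V (f z) by rewrite (_ : f z = w)//;
      apply: (@cmap_inj _ _ _ c); rewrite ?inE//; rewrite fE wE.
    by [].
  move=> [[Uz zc] Vf]; split=> //.
  by have [fc fE] := fP z (conj Uz zc); exists (f z).
rewrite WE; split; first exact: smooth_preimage.
exists f; split; last first.
  move=> z Vz; have [Wz Vf] : (W `&` f @^-1` V) z by rewrite -WE.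
  by have [fc fE] := fP z Wz.
by apply: (smooth_sub oW _ _ sf); [exact: smooth_preimage|move=> y []].
Qed.

(** The open sets of the D-topology, the finest one making all plots continuous. *)
Definition dopen X (O : set X) : Prop :=
  forall m (U : set 'rV[R]_m) p, plot U p -> open (U `&` p @^-1` O).

(** Hence the topology of a manifold depends on its diffeology alone, and Hausdorffness and
    countable bases can be transferred between spaces with unrelated atlases. *)
Lemma atlas_openP X n (A : set (chart R X n)) (O : set X) : manifold_atlas A ->
  atlas_open A O <-> dopen O.
Proof.
move=> mA; split=> [oO m U p pp|dO c Ac]; last first.
  by apply: dO; have [] := atlas_dchart mA Ac.
apply: open_local => z [Uz Oz].
have [c Ac zc] := atlas_chart (p z) mA.
have [W [f [[oW Wz] WU sf fP]]] := dchart_read (atlas_dchart mA Ac) pp Uz zc.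
exists (W `&` f @^-1` (cdom c `&` cmap c @^-1` O)); split.
- by apply: smooth_preimage => //; exact: oO.
- by have [fc fE] := fP z Wz; split=> //; split=> //=; rewrite fE.
- by move=> y [Wy [fc /= fO]]; have [_ <-] := fP y Wy; split=> //; exact: WU.
Qed.

Lemma atlas_space_openP X n (A : set (chart R X n)) (O : set (atlas_space A)) :
  manifold_atlas A -> open O <-> dopen (O : set X).
Proof. exact: atlas_openP. Qed.

Lemma dchart_image_dopen X n (c : chart R X n) : dchart c ->
  dopen (cmap c @` cdom c).
Proof. by move=> [_ dc] m U p /dc[]. Qed.

End Charts.

(** * Submersions as maps with the pointed lifting property *)

Section LocalSubduction.
Context (R : realType).
Implicit Types (X Y Z : diffSpace R).

(** A subduction fixes only the plot to be lifted; here the value of the lift at one point is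
    prescribed too. Surjectivity is not implied and is supplied separately where a subduction is
    wanted. *)
Definition local_subduction X Y (F : X -> Y) : Prop :=
  forall n (U : set 'rV[R]_n) p z x, plot U p -> U z -> F x = p z ->
    exists V q, [/\ V z /\ V `<=` U, plot V q,
      forall y, V y -> F (q y) = p y & q z = x].

Lemma set_inj_eq (S T : Type) (A : set S) (f : S -> T) x y :
  set_inj A f -> A x -> A y -> f x = f y -> x = y.
Proof. by move=> fI Ax Ay; apply: fI; exact: mem_set. Qed.

(** The inverse chart of [Y] is a plot. Its lift through the given point, read in the chart of [X],
    is a smooth local right inverse [g] of the local expression [f], so the chain rule makes ['d f]
    surjective. *)
Lemma local_subduction_submersion X Y (F : X -> Y) :
  weak_manifold X -> weak_manifold Y -> dsmooth F -> local_subduction F ->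
  submersion F.
Proof.
move=> [n [A mA]] [m [B mB]] sF lF; split=> //; exists n, m, A, B; split=> //.
move=> c d z Ac Bd cz dFz.
have [pc dc] := atlas_dchart mA Ac; have [pd dd] := atlas_dchart mB Bd.
have [W [f [[oW Wz] Wc sf fP]]] := dchart_read (conj pd dd) (sF _ _ _ pc) cz dFz.
exists W, f; split=> //.
have [dfz fzE] := fP z Wz.
have [V [q [[Vw VU] pq qP qw]]] := lF _ _ _ _ (cmap c z) pd dfz (esym fzE).
have cq : (cmap c @` cdom c) (q (f z)) by exists z; rewrite ?qw.
have [W' [g [[oW' W'w] W'V sg gP]]] := dchart_read (conj pc dc) pq Vw cq.
have gw : g (f z) = z.
  have [gc gE] := gP _ W'w.
  by apply: (set_inj_eq (@cmap_inj _ _ _ c)) => //; rewrite gE.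
have Wg : open (W' `&` g @^-1` W) by exact: smooth_preimage.
have fgE y : (W' `&` g @^-1` W) y -> f (g y) = y.
  move=> [W'y Wgy]; have [_ gE] := gP _ W'y; have [dfg fE] := fP _ Wgy.
  have Vy := W'V _ W'y.
  apply: (set_inj_eq (@cmap_inj _ _ _ d)) => //; first exact: VU.
  by rewrite fE/= gE qP.
have dg : differentiable g (f z) by exact: (smooth_differentiable oW' sg).
have df : differentiable f (g (f z)).
  by rewrite gw; exact: (smooth_differentiable oW sf).
have Wfz : (W' `&` g @^-1` W) (f z) by split=> //=; rewrite gw.
move=> v _; exists ('d g (f z) v) => //.
have := diff_comp dg df => /(congr1 (fun h => h v)) /=; rewrite gw => <-.
rewrite -deriveE; last exact: differentiable_comp.
rewrite (@near_eq_derive _ _ _ (f \o g) id); first by rewrite derive_id.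
exact: (near_eq_in Wg Wfz fgE).
Qed.

(** In normal form [F] is a projection: the plot is lifted by keeping the remaining coordinates
    constant, equal to those of the prescribed point. *)
Lemma submersion_local_subduction X Y (F : X -> Y) :
  submersion F -> local_subduction F.
Proof.
move=> [sF [n [m [A [B [mA mB sub]]]]]] k U p z x pp Uz Fx.
have [c Ac [x0 cx0 xE]] := atlas_chart x mA.
have [d Bd dz] := atlas_chart (p z) mB.
subst x.
have [|W [f [[oW Wx0] Wc sf fP surj]]] := sub c d x0 Ac Bd cx0; first by rewrite Fx.
have [pc _] := atlas_dchart mA Ac; have dd := atlas_dchart mB Bd.
have [W1 [r [[oW1 W1z] W1U sr rP]]] := dchart_read dd pp Uz dz.
have nm : (m <= n)%N.
  by have /eqP <- := surj_row_full surj; exact: rank_leq_row.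
have [l nE] : exists l, n = (m + l)%N by exists (n - m)%N; rewrite subnKC.
subst n.
have [N [V [e [h [[oN Nx0] NW oV [se sh] [eP hP lE]]]]]] :=
  submersion_normal_form oW sf Wx0 surj.
have rz : r z = f x0.
  have [dr rE] := rP z W1z; have [df fE] := fP _ Wx0.
  by apply: (set_inj_eq (@cmap_inj _ _ _ d)) => //; rewrite rE fE Fx.
pose s y := row_mx (r y) (rsubmx (e x0)).
have ss : smooth_on W1 s by apply: smooth_row_mx => //; exact: smooth_cst.
have sz : s z = e x0 by rewrite /s rz -lE// hsubmxK.
pose V1 := W1 `&` s @^-1` V.
have oV1 : open V1 by exact: smooth_preimage.
have shs : smooth_on V1 (h \o s).
  apply: (smooth_comp oV oV1 _ sh) => [y []//|].
  by apply: (smooth_sub oW1 oV1 _ ss) => y [].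
have hW y : V1 y -> W (h (s y)) by move=> [_ /hP[/NW]].
exists V1, (cmap c \o (h \o s)); split.
- split=> [|y [/W1U//]].
  by split=> //=; rewrite sz; have [] := eP _ Nx0.
- by apply: (plot_comp pc oV1 shs) => y /hW/Wc.
- move=> y V1y; have [_ /= <-] := fP _ (hW y V1y).
  have [W1y Vs] := V1y; have [Nh ehE] := hP _ Vs.
  by rewrite -lE// ehE /s row_mxKl; have [] := rP y W1y.
- by rewrite /= sz; have [_ ->] := eP _ Nx0.
Qed.

End LocalSubduction.

(** * Fibre products along a submersion *)

Section FibreProduct.
Context (R : realType).

Lemma sval_inj (T : Type) (P : T -> Prop) (x y : {t | P t}) :
  sval x = sval y -> x = y.
Proof. by case: x y => [x px] [y py] /= e; exact: eq_exist. Qed.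

Lemma sig_extension (S T : Type) (P : T -> Prop) (t0 : {t | P t}) (D : set S)
    (phi : S -> T) :
  (forall z, D z -> P (phi z)) ->
  exists psi : S -> {t | P t}, forall z, D z -> sval (psi z) = phi z.
Proof.
move=> DP.
have /choice[psi psiP] : forall z, exists t : {t | P t}, D z -> sval t = phi z.
  by move=> z; have [/DP Pz|nDz] := pselect (D z); [exists (exist _ _ Pz)|exists t0].
by exists psi.
Qed.

(** Where [g] is a projection in normal form, a pair is determined by coordinates of its first
    component and the free coordinates of its second; the other coordinates of the second are forced
    by [f]. *)
Lemma fibD_weak_manifold (X Y Z : diffSpace R) (f : X -> Z) (g : Y -> Z) :
  weak_manifold X -> dsmooth f -> submersion g -> weak_manifold (fibD f g).
Proof.
move=> /weak_manifoldP[p covX] sf [sg [n [m [A [B [mA mB sub]]]]]].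
(* The dimension has to be named before any point is available; [m <= n] is then derived at a point,
   from the surjective differential. *)
apply/weak_manifoldP; exists (p + (n - m))%N => xy.
have /= fgxy := svalP xy.
have [b [db [v0 bv0 v0E]]] := covX (sval xy).1.
have [c Ac [w0 cw0 w0E]] := atlas_chart (sval xy).2 mA.
have [d Bd dz] := atlas_chart (f (sval xy).1) mB.
have [|W [phi [[oW Ww0] Wc sphi phiP surj]]] := sub c d w0 Ac Bd cw0.
  by rewrite w0E -fgxy.
have dc := atlas_dchart mA Ac; have dd := atlas_dchart mB Bd.
have [pb _] := db.
have [|Wb [r [[oWb Wbv0] Wbb sr rP]]] := dchart_read (z := v0) dd (sf _ _ _ pb) bv0.
  by rewrite /= v0E.
have nm : (m <= n)%N.
  by have /eqP <- := surj_row_full surj; exact: rank_leq_row.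
have [l lE nE] : exists2 l, l = (n - m)%N & n = (m + l)%N.
  by exists (n - m)%N; rewrite ?subnKC.
rewrite -lE; clear lE nm; subst n.
have [N [V [e [h [[oN Nw0] NW oV [se sh] [eP hP lE]]]]]] :=
  submersion_normal_form oW sphi Ww0 surj.
have [b' [db' b'E b'm]] := dchart_restrict db oWb.
have [c' [dc' c'E c'm]] := dchart_restrict dc oN.
have d_inj x y : cdom d x -> cdom d y -> cmap d x = cmap d y -> x = y.
  exact: (set_inj_eq (@cmap_inj _ _ _ d)).
(* Normal-form coordinates of the second component: [r] is [f] read in the charts [b] and [d], and
   gives the forced part. *)
pose s (u : 'rV[R]_(p + l)) := row_mx (r (lsubmx u)) (rsubmx u).
pose D0 := [set u : 'rV[R]_(p + l) | Wb (lsubmx u)].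
have sl : smooth_on [set: 'rV[R]_(p + l)] (fun u => lsubmx u).
  by apply: smooth_lsubmx; [exact: openT|exact: smooth_id openT].
have oD0 : open D0 by have := smooth_preimage openT sl oWb; rewrite setTI.
have ss : smooth_on D0 s.
  apply: smooth_row_mx => //; last by apply: smooth_rsubmx => //; exact: smooth_id.
  apply: (smooth_comp oWb oD0 _ sr) => //.
  by apply: smooth_sub sl => //; exact: openT.
pose D := D0 `&` s @^-1` V.
have oD : open D by exact: smooth_preimage.
have hsN u : D u -> [/\ cdom c (h (s u)), N (h (s u)) & lsubmx (e (h (s u))) = r (lsubmx u)].
  move=> [Du /hP[Nh ehE]]; split=> //; first exact/Wc/NW.
  by rewrite ehE row_mxKl.
have [psi psiP] : exists psi : 'rV[R]_(p + l) -> fibD f g,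
    forall u, D u -> sval (psi u) = (cmap b (lsubmx u), cmap c (h (s u))).
  apply: (sig_extension xy) => u Du /=; have [ch Nh le] := hsN u Du.
  have [dr /= <-] := rP _ Du.1; rewrite -le.
  by have [_ <-] := phiP _ (NW _ Nh); rewrite -lE.
have psi_inj : set_inj D psi.
  move=> u u' /set_mem Du /set_mem Du' /(congr1 sval); rewrite !psiP// => -[E1 E2].
  have [ch Nh le] := hsN u Du; have [ch' Nh' le'] := hsN u' Du'.
  have lu : lsubmx u = lsubmx u'.
    by apply: (set_inj_eq (@cmap_inj _ _ _ b)) => //; apply: Wbb; [case: Du|case: Du'].
  have hu : h (s u) = h (s u') by exact: (set_inj_eq (@cmap_inj _ _ _ c)).
  have /(congr1 rsubmx) : s u = s u'.
    by have [_ <-] := hP _ Du.2; have [_ <-] := hP _ Du'.2; rewrite hu.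
  by rewrite !row_mxKr => ru; rewrite -[u]hsubmxK -[u']hsubmxK lu ru.
(* the pairs read by the chart [psi] are those whose components are read by two
   smaller charts *)
have read v w : Wb v -> cdom c w -> N w -> f (cmap b v) = g (cmap c w) ->
    let u := row_mx v (rsubmx (e w)) in D u /\ h (s u) = w.
  move=> Wv cw Nw fg u.
  have su : s u = e w.
    rewrite /s /u row_mxKl row_mxKr -[e w]hsubmxK row_mxKr; congr row_mx.
    have [dr /= rE] := rP _ Wv; have [dw pE] := phiP _ (NW _ Nw).
    by rewrite lE//; apply: d_inj => //; rewrite rE pE.
  have [Vew hew] := eP _ Nw.
  by split; [split|]; rewrite /= ?su//; rewrite /D0/= row_mxKl.
have ph : smooth_on D (fun u => h (s u)).
  apply: (smooth_comp oV oD _ sh) => [u []//|].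
  by apply: (smooth_sub oD0 oD _ ss) => u [].
have ppsi : plot D psi.
  split.
  - have P1 : plot D (cmap b \o (fun u => lsubmx u)).
      apply: (plot_comp pb oD) => [|u [/Wbb//]].
      by apply: smooth_sub sl => //; exact: openT.
    by apply: (plot_ext P1) => u Du; rewrite /= psiP.
  - have P2 : plot D (cmap c \o (fun u => h (s u))).
      by apply: (plot_comp dc.1 oD ph) => u /hsN[].
    by apply: (plot_ext P2) => u Du; rewrite /= psiP.
have cbE : cdom b' = Wb.
  by rewrite b'E; apply/seteqP; split=> [v []//|v Wv]; split=> //; exact: Wbb.
exists (Chart oD psi_inj); split; last first.
  have Wv0 : Wb v0 by [].
  have [|Du hu] := read v0 w0 Wv0 cw0 Nw0; first by rewrite v0E w0E.
  exists (row_mx v0 (rsubmx (e w0))) => //=.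
  apply: sval_inj; rewrite psiP// hu row_mxKl v0E w0E.
  by case: (sval xy).
split=> // k U q [pq1 pq2]; rewrite /smooth_in_chart/=.
have [oW1 [f1 [sf1 f1P]]] := db'.2 _ _ _ pq1.
have [oW2 [f2 [sf2 f2P]]] := dc'.2 _ _ _ pq2.
set W1 := U `&` _ in oW1 sf1 f1P; set W2 := U `&` _ in oW2 sf2 f2P.
rewrite cbE b'm in f1P; rewrite c'E c'm in f2P.
have fP y : W1 y -> W2 y -> let u := row_mx (f1 y) (rsubmx (e (f2 y))) in
    D u /\ psi u = q y.
  move=> /f1P[Wf f1E] /f2P[[cf Nf] f2E] u.
  have [|Du hu] := read _ _ Wf cf Nf; first by rewrite f1E f2E; exact: svalP (q y).
  split=> //; apply: sval_inj; rewrite psiP// hu row_mxKl f1E f2E.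
  by case: (sval (q y)).
have WE : U `&` q @^-1` (psi @` D) = W1 `&` W2.
  apply/seteqP; split=> y; last first.
    move=> [W1y W2y]; have [Du uE] := fP y W1y W2y.
    by split; [case: W1y|exists (row_mx (f1 y) (rsubmx (e (f2 y))))].
  move=> [Uy [u Du uE]]; have [ch Nh le] := hsN u Du.
  have sE := psiP u Du; rewrite uE in sE.
  split; split=> //=; rewrite sE/=.
    by rewrite cbE b'm; exists (lsubmx u) => //; case: Du.
  by rewrite c'E c'm; exists (h (s u)).
have oW12 : open (W1 `&` W2) by exact: openI.
rewrite WE; split=> //; exists (fun y => row_mx (f1 y) (rsubmx (e (f2 y)))); split.
  apply: smooth_row_mx => //; first by apply: (smooth_sub oW1 oW12 _ sf1) => y [].
  apply: smooth_rsubmx => //.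
  apply: (smooth_comp oN oW12 _ se); first by move=> y [_ /f2P[[]]].
  by apply: (smooth_sub oW2 oW12 _ sf2) => y [].
move=> y Wy; have [W1y W2y] : (W1 `&` W2) y by rewrite -WE.
exact: fP.
Qed.

End FibreProduct.

Section Subductions.
Context (R : realType).
Implicit Types (X Y : diffSpace R).

Lemma diffeomorphism_weak_manifold X Y (F : X -> Y) :
  diffeomorphism F -> weak_manifold X -> weak_manifold Y.
Proof.
move=> [sF [F' [FK F'K sF']]] /weak_manifoldP[n cov].
apply/weak_manifoldP; exists n => y; have [c [[pc dc] [v cv vE]]] := cov (F' y).
have iF : set_inj (cdom c) (F \o cmap c).
  move=> u v' uc vc /(can_inj FK); exact: cmap_inj.
exists (Chart (@cdom_open _ _ _ c) iF); split; last first.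
  by exists v => //=; rewrite vE.
split; first exact: sF.
move=> m U p /sF'/dc [oW [f [sf fP]]]; rewrite /smooth_in_chart/=.
have WE : U `&` p @^-1` ((F \o cmap c) @` cdom c) =
    U `&` (F' \o p) @^-1` (cmap c @` cdom c).
  apply/seteqP; split=> z [Uz [w cw wE]]; split=> //; exists w => //=.
    by rewrite -wE/= FK.
  by rewrite /= wE/= F'K.
rewrite WE; split=> //; exists f; split=> // z Wz.
have {Wz} : (U `&` (F' \o p) @^-1` (cmap c @` cdom c)) z by rewrite -WE.
move=> /fP[fc fE].
by split=> //; rewrite fE/= F'K.
Qed.

Lemma subduction_lift X Y (F : X -> Y) n (U : set 'rV[R]_n) p z :
  subduction F -> plot U p -> U z ->
  exists V q, [/\ V z, V `<=` U, plot V q & forall y, V y -> p y = F (q y)].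
Proof.
move=> [_ _ H] /H[C [_ CU CP]] Uz.
have : (\bigcup_(V in C) V) z by rewrite CU.
move=> [V CV Vz]; have [q [pq qP]] := CP _ CV.
by exists V, q; split=> // y Vy; rewrite -CU; exists V.
Qed.

Lemma subduction_intro X Y (F : X -> Y) :
  dsmooth F ->
  (forall n (U : set 'rV[R]_n) p z, plot U p -> U z ->
    exists V q, [/\ V z, V `<=` U, plot V q & forall y, V y -> p y = F (q y)]) ->
  subduction F.
Proof.
move=> sF H; split=> // [y _|n U p pp].
  (* Surjectivity is the lifting of points, seen as plots on the 0-dimensional space. *)
  have py : plot [set: 'rV[R]_0] (fun=> y) by apply: plot_cst; exact: openT.
  have [V [q [V0 _ _ qP]]] := H 0 _ _ 0 py I.
  by exists (q 0); rewrite // -qP.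
exists [set V | V `<=` U /\ exists q : 'rV[R]_n -> X,
  plot V q /\ forall y, V y -> p y = F (q y)]; split.
- by move=> V [_ [q [pq _]]]; exact: plot_open pq.
- apply/seteqP; split=> [z [V [VU _] /VU//]|z Uz].
  by have [V [q [Vz VU pq qP]]] := H _ _ _ _ pp Uz; exists V => //; split=> //; exists q.
- by move=> V [].
Qed.

Lemma local_subduction_subduction X Y (F : X -> Y) :
  dsmooth F -> set_surj [set: X] [set: Y] F -> local_subduction F -> subduction F.
Proof.
move=> sF surj lF; apply: subduction_intro => // n U p z pp Uz.
have [x _ xE] := surj (p z) I.
have [V [q [[Vz VU] pq qP _]]] := lF _ _ _ _ _ pp Uz xE.
by exists V, q; split=> // y /qP.
Qed.

(** Plots are total functions, so a corestriction needs a value outside [U]; a point of [U] provides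
    one, since the subset itself might be empty. *)
Lemma plot_sig X (P : X -> Prop) n (U : set 'rV[R]_n) (p : 'rV[R]_n -> X) :
  plot U p -> (forall z, U z -> P (p z)) -> U !=set0 ->
  exists q : 'rV[R]_n -> @subD R X P, plot U q /\ forall z, U z -> sval (q z) = p z.
Proof.
move=> pp UP [z0 Uz0].
have [q qP] := sig_extension (exist _ _ (UP _ Uz0)) UP.
by exists q; split=> //; apply: (plot_ext pp) => z Uz; rewrite qP.
Qed.

End Subductions.

(** * Groupoids and weak equivalences *)

Section Groupoids.
Context (R : realType).
Implicit Types (G H : dgroupoid R).

(** A total version of [mul], with the junk value [g] when the arrows are not composable; equations
    can then be rewritten without transporting proofs. *)
Definition cmp G (g h : ar G) : ar G :=
  if pselect (src g = tgt h) is left e then mul e else g.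

Lemma cmpE G (g h : ar G) (e : src g = tgt h) : cmp g h = mul e.
Proof. by rewrite /cmp; case: pselect => // e'; exact: eq_mul. Qed.

Lemma src_cmp G (g h : ar G) : src g = tgt h -> src (cmp g h) = src h.
Proof. by move=> e; rewrite cmpE src_mul. Qed.

Lemma tgt_cmp G (g h : ar G) : src g = tgt h -> tgt (cmp g h) = tgt g.
Proof. by move=> e; rewrite cmpE tgt_mul. Qed.

Lemma cmpA G (f g h : ar G) : src f = tgt g -> src g = tgt h ->
  cmp (cmp f g) h = cmp f (cmp g h).
Proof.
move=> e e'; rewrite (cmpE e) (cmpE e').
have el : src (mul e) = tgt h by rewrite src_mul.
have er : src f = tgt (mul e') by rewrite tgt_mul.
by rewrite (cmpE el) (cmpE er); exact: mul_assoc.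
Qed.

Lemma cmp1g G (g : ar G) x : tgt g = x -> cmp (unt x) g = g.
Proof.
move=> <-; have e : src (unt (tgt g)) = tgt g by rewrite src_unt.
by rewrite (cmpE e) mul_unt_l.
Qed.

Lemma cmpg1 G (g : ar G) x : src g = x -> cmp g (unt x) = g.
Proof.
move=> <-; have e : src g = tgt (unt (src g)) by rewrite tgt_unt.
by rewrite (cmpE e) mul_unt_r.
Qed.

Lemma cmpVg G (g : ar G) : cmp (inv g) g = unt (src g).
Proof.
have e : src (inv g) = tgt g by rewrite src_inv.
by rewrite (cmpE e) mul_inv_l.
Qed.

Lemma cmpgV G (g : ar G) : cmp g (inv g) = unt (tgt g).
Proof.
have e : src g = tgt (inv g) by rewrite tgt_inv.
by rewrite (cmpE e) mul_inv_r.
Qed.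

Lemma cmpKg G (g h : ar G) : src g = tgt h -> cmp (inv g) (cmp g h) = h.
Proof. by move=> e; rewrite -cmpA ?src_inv// cmpVg cmp1g. Qed.

Lemma far_cmp G H (phi : dfunctor G H) (g h : ar G) : src g = tgt h ->
  far phi (cmp g h) = cmp (far phi g) (far phi h).
Proof.
move=> e; have e' : src (far phi g) = tgt (far phi h) by rewrite far_src far_tgt e.
by rewrite (cmpE e) (cmpE e') (far_mul e e').
Qed.

Lemma plot_cmp G n (U : set 'rV[R]_n) (p q : 'rV[R]_n -> ar G) :
  plot U p -> plot U q -> (forall z, U z -> src (p z) = tgt (q z)) ->
  plot U (fun z => cmp (p z) (q z)).
Proof.
move=> pp pq e; have [U0|/set0P/negP/negPn/eqP U0] := pselect (U !=set0); last first.
  by apply: plot_cover => z; rewrite U0.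
have ppq : @plot R (prodD (ar G) (ar G)) n U (fun z => (p z, q z)) by split.
have [r [pr rP]] := plot_sig (X := prodD (ar G) (ar G))
  (P := fun gh => src gh.1 = tgt gh.2) ppq e U0.
apply: (plot_ext (mul_smooth pr)) => z Uz /=.
by rewrite -cmpE rP.
Qed.

Lemma fob_smooth G H (phi : dfunctor G H) : dsmooth (fob phi).
Proof.
move=> n U p /unt_smooth/(far_smooth phi)/src_smooth P.
by apply: (plot_ext P) => z _ /=; rewrite far_src src_unt.
Qed.

Lemma Psi_smooth G H (phi : dfunctor G H) : dsmooth (@Psi R G H phi).
Proof. by move=> n U p [_ p2]; exact: src_smooth. Qed.

Lemma Phi_smooth G H (phi : dfunctor G H) : dsmooth (@Phi R G H phi).
Proof.
by move=> n U p pp; split; [split; [exact: src_smooth|exact: tgt_smooth]|exact: far_smooth].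
Qed.

Lemma Phi_faithful G H (phi : dfunctor G H) (k k' : ar G) :
  diffeomorphism (@Phi R G H phi) ->
  src k = src k' -> tgt k = tgt k' -> far phi k = far phi k' -> k = k'.
Proof.
move=> [_ [F' [FK _ _]]] es et ef; apply: (can_inj FK).
by apply: sval_inj => /=; rewrite es et ef.
Qed.

(** Full faithfulness in usable form: [L x x' h] is the arrow from [x] to [x'] over [h], and it
    depends smoothly on all three. *)
Lemma Phi_lift G H (phi : dfunctor G H) : diffeomorphism (@Phi R G H phi) ->
  exists L : ob G -> ob G -> ar H -> ar G,
    (forall x x' h, src h = fob phi x -> tgt h = fob phi x' ->
       [/\ src (L x x' h) = x, tgt (L x x' h) = x' & far phi (L x x' h) = h]) /\
    (forall n (U : set 'rV[R]_n) p p' q, plot U p -> plot U p' -> plot U q ->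
       (forall z, U z -> src (q z) = fob phi (p z) /\ tgt (q z) = fob phi (p' z)) ->
       plot U (fun z => L (p z) (p' z) (q z))).
Proof.
move=> [_ [F' [FK F'K sF']]].
pose L x x' h : ar G :=
  if pselect (src h = fob phi x /\ tgt h = fob phi x') is left e
  then F' (exist _ ((x, x'), h) e) else unt x.
have LE (w : Phi_cod phi) : L (sval w).1.1 (sval w).1.2 (sval w).2 = F' w.
  rewrite /L; case: pselect => [e|]; last by case; exact: svalP w.
  by congr F'; apply: sval_inj => /=; case: (sval w) => -[].
exists L; split=> [x x' h e e'|n U p p' q pp pp' pq e].
  pose w : Phi_cod phi := exist _ ((x, x'), h) (conj e e').
  have /(congr1 sval) := F'K w; rewrite -LE /= => -[E1 E2 E3].
  by split.
have [U0|/set0P/negP/negPn/eqP U0] := pselect (U !=set0); last first.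
  by apply: plot_cover => z; rewrite U0.
have ppq : @plot R (prodD (prodD (ob G) (ob G)) (ar H)) n U
  (fun z => ((p z, p' z), q z)) by split.
have [r [pr rP]] := plot_sig (X := prodD (prodD (ob G) (ob G)) (ar H))
  (P := fun z => src z.2 = fob phi z.1.1 /\ tgt z.2 = fob phi z.1.2) ppq e U0.
apply: (plot_ext (sF' _ _ _ pr)) => z Uz /=.
by rewrite -LE rP.
Qed.

(* A lift of a plot through [Psi] is moved through the prescribed point by a
   local section of the target map of [G]. *)
Lemma Psi_local_subduction G H (phi : dfunctor G H) :
  weak_equivalence phi -> local_subduction (@tgt R G) ->
  local_subduction (@Psi R G H phi).
Proof.
move=> [subPsi dPhi] lt n U p z xh pp Uz.
have [L [LP _]] := Phi_lift dPhi.
case: xh => -[x h] /= xh; rewrite /Psi/= => hz.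
have [V [q [Vz VU [pq1 pq2] qP]]] := subduction_lift subPsi pp Uz.
have qz : src (sval (q z)).2 = src h by rewrite hz qP.
have qe y : fob phi (sval (q y)).1 = tgt (sval (q y)).2 := svalP (q y).
have e1 : src (sval (q z)).2 = tgt (inv h) by rewrite tgt_inv.
(* The arrow from [x] to the object of the lift at [z] that measures how far this lift is from the
   prescribed [(x, h)]. *)
have [||k1 k2 k3] := LP x (sval (q z)).1 (cmp (sval (q z)).2 (inv h)).
- by rewrite src_cmp// src_inv.
- by rewrite tgt_cmp// qe.
have [V2 [r [[V2z V2V] pr rP rz]]] := lt _ _ _ _ _ pq1 Vz k2.
have e y : V2 y -> src (inv (far phi (r y))) = tgt (sval (q y)).2.
  by move=> Vy; rewrite src_inv far_tgt rP// qe.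
(* Translation by the inverse of [r y] leaves [Psi] unchanged, and at [z] it produces exactly
   [(x, h)]. *)
pose s y := (src (r y), cmp (inv (far phi (r y))) (sval (q y)).2).
have ps : @plot R (prodD (ob G) (ar H)) n V2 s.
  split; first exact: src_smooth.
  apply: plot_cmp => //; first exact/inv_smooth/far_smooth.
  by apply: plot_sub pq2 _ V2V; exact: plot_open pr.
have sP y : V2 y -> fob phi (s y).1 = tgt (s y).2.
  by move=> Vy; rewrite /s/= tgt_cmp ?e// tgt_inv far_src.
have [s' [ps' s'E]] := plot_sig (X := prodD (ob G) (ar H))
  (P := fun xh => fob phi xh.1 = tgt xh.2) ps sP (ex_intro _ z V2z).
exists V2, s'; split=> //.
- by split=> // y /V2V/VU.
- move=> y Vy; rewrite /Psi s'E//= src_cmp ?e// qP//.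
  exact: V2V.
- apply: sval_inj; rewrite s'E//= /s rz k1 k3; congr pair.
  rewrite -[in RHS](cmpKg (g := cmp (sval (q z)).2 (inv h)) (h := h)); last first.
    by rewrite src_cmp// src_inv.
  by rewrite cmpA// ?src_inv// cmpVg cmpg1.
Qed.

End Groupoids.

(** * The groupoid induced on the source of a map to the objects *)

Section InducedGroupoid.
Context (R : realType) (G : dgroupoid R) (X : diffSpace R) (f : X -> ob G).
Context (sf : dsmooth f).

Let iar : diffSpace R := @subD R (prodD (prodD X X) (ar G))
  (fun z => src z.2 = f z.1.1 /\ tgt z.2 = f z.1.2).

Let isrc (k : iar) : X := (sval k).1.1.
Let itgt (k : iar) : X := (sval k).1.2.

Lemma induced_unt_subproof x : src (unt (f x)) = f x /\ tgt (unt (f x)) = f x.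
Proof. by rewrite src_unt tgt_unt. Qed.

Lemma induced_inv_subproof (k : iar) :
  src (inv (sval k).2) = f (itgt k) /\ tgt (inv (sval k).2) = f (isrc k).
Proof. by rewrite src_inv tgt_inv; case: (svalP k). Qed.

Lemma induced_mul_src (k l : iar) : isrc k = itgt l ->
  src (sval k).2 = tgt (sval l).2.
Proof.
by case: (svalP k) (svalP l) => [e _] [_ e'] kl; rewrite e e' -/(isrc k) kl.
Qed.

Lemma induced_mul_subproof (k l : iar) (e : isrc k = itgt l) :
  src (mul (induced_mul_src e)) = f (isrc l) /\
  tgt (mul (induced_mul_src e)) = f (itgt k).
Proof. by rewrite src_mul tgt_mul; case: (svalP k) (svalP l) => [? ?] [? ?]. Qed.

Let iunt (x : X) : iar := exist _ ((x, x), unt (f x)) (induced_unt_subproof x).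
Let iinv (k : iar) : iar :=
  exist _ ((itgt k, isrc k), inv (sval k).2) (induced_inv_subproof k).
Let imul (k l : iar) (e : isrc k = itgt l) : iar :=
  exist _ ((isrc l, itgt k), mul (induced_mul_src e)) (induced_mul_subproof e).

Let iar_eq (k l : iar) : isrc k = isrc l -> itgt k = itgt l ->
  (sval k).2 = (sval l).2 -> k = l.
Proof.
rewrite /isrc /itgt => e1 e2 e3; apply: sval_inj.
by case: (sval k) (sval l) e1 e2 e3 => [[? ?] ?] [[? ?] ?] /= -> -> ->.
Qed.

Lemma induced_mul_smooth :
  @dsmooth R (fibD isrc itgt) iar (fun kl => imul (proj2_sig kl)).
Proof.
move=> n U p [[[p1 p2] p3] [[q1 q2] q3]]; split; first by split.
have : plot U (fun z => cmp (sval (sval (p z)).1).2 (sval (sval (p z)).2).2).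
  by apply: plot_cmp => // z _; exact: induced_mul_src (svalP (p z)).
move=> H; apply: (plot_ext H) => z _ /=.
by rewrite (cmpE (induced_mul_src (proj2_sig (p z)))).
Qed.

Definition induced_groupoid : dgroupoid R.
Proof.
apply: (@DGroupoid R X iar isrc itgt iunt iinv imul).
- by [].
- by [].
- by [].
- by [].
- by [].
- by [].
- by move=> k l m e e' el er; apply: iar_eq => //=; exact: mul_assoc.
- move=> k e; apply: iar_eq => //=; rewrite -cmpE cmp1g//.
  by case: (svalP k).
- move=> k e; apply: iar_eq => //=; rewrite -cmpE cmpg1//.
  by case: (svalP k).
- move=> k e; apply: iar_eq => //=; rewrite -cmpE cmpVg.
  by case: (svalP k) => ->.
- move=> k e; apply: iar_eq => //=; rewrite -cmpE cmpgV.
  by case: (svalP k) => _ ->.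
- by move=> n U p [[]].
- by move=> n U p [[]].
- by move=> n U p pp; split; [split|exact/unt_smooth/sf].
- by move=> n U p [[p1 p2] p3]; split; [split|exact: inv_smooth].
- exact: induced_mul_smooth.
Defined.

Definition induced_functor : dfunctor induced_groupoid G.
Proof.
apply: (@DFunctor R induced_groupoid G f (fun k => (sval k).2)).
- by move=> k; case: (svalP k).
- by move=> k; case: (svalP k).
- by [].
- by move=> k l e e'; exact: eq_mul.
- by move=> n U p [].
Defined.

(** The arrows of the induced groupoid are by construction the codomain of [Phi], so the inverse is
    the identity. *)
Lemma induced_Phi_diffeomorphism :
  diffeomorphism (@Phi R induced_groupoid G induced_functor).
Proof.
split; first exact: Phi_smooth.
exists (fun z : Phi_cod induced_functor => z : ar induced_groupoid); split.
- by move=> k; apply: iar_eq.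
- by move=> [[[x x'] g] e]; exact: sval_inj.
- by move=> n U p.
Qed.

(** An induced arrow into [p y] is an arrow of [G] into [f (p y)] with a preimage of its source. The
    former is lifted along [tgt], then its source along [f]. *)
Lemma induced_tgt_local_subduction :
  local_subduction f -> local_subduction (@tgt R G) ->
  local_subduction (@tgt R induced_groupoid).
Proof.
move=> lf lt n U p z k pp Uz kz.
have [||V [q [[Vz VU] pq qP qz]]] := lt n U (f \o p) z (sval k).2 _ Uz.
- exact: sf.
- by rewrite /= -kz; case: (svalP k).
have [||W [r [[Wz WV] pr rP rz]]] := lf n V (@src R G \o q) z (isrc k) _ Vz.
- exact: src_smooth.
- by rewrite /= qz; case: (svalP k).
have oW := plot_open pr.
pose w y : prodD (prodD X X) (ar G) := ((r y, p y), q y).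
have pw : plot W w.
  split; [split=> //|exact: plot_sub pq oW WV].
  by apply: plot_sub pp oW _ => y /WV/VU.
have [w' [pw' w'E]] := plot_sig
  (P := fun z : prodD (prodD X X) (ar G) => src z.2 = f z.1.1 /\ tgt z.2 = f z.1.2)
  pw (fun y Wy => conj (esym (rP y Wy)) (qP y (WV _ Wy))) (ex_intro _ z Wz).
exists W, w'; split=> //.
- by split=> // y /WV/VU.
- by move=> y Wy; rewrite /tgt/= /itgt w'E.
- by apply: iar_eq; rewrite ?/isrc ?/itgt w'E.
Qed.

Lemma induced_src_local_subduction :
  local_subduction (@tgt R induced_groupoid) ->
  local_subduction (@src R induced_groupoid).
Proof.
move=> lt n U p z k pp Uz kz.
have [|V [q [VzU pq qP qz]]] := lt _ _ _ _ (inv k) pp Uz.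
  by rewrite tgt_inv.
exists V, (fun y => inv (q y)); split=> //; first exact: inv_smooth.
rewrite qz; apply: iar_eq => //=.
(* Shows that inversion is involutive, by cancelling [inv g]. *)
rewrite -[RHS](cmpKg (g := inv (sval k).2)) ?src_inv//.
by rewrite cmpVg cmpg1// src_inv tgt_inv.
Qed.

End InducedGroupoid.

(** * Disjoint unions of open sets *)

Section DiscreteDiffeology.
Context (R : realType) (I : Type).

(** The locally constant maps: a plot of the disjoint union stays locally on one sheet. *)
Let dplot n (U : set 'rV[R]_n) (p : 'rV[R]_n -> I) : Prop :=
  open U /\ forall i, open (U `&` p @^-1` [set i]).

Lemma discD_open n (U : set 'rV[R]_n) p : dplot U p -> open U.
Proof. by case. Qed.

Lemma discD_ext n (U : set 'rV[R]_n) p q :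
  dplot U p -> (forall z, U z -> p z = q z) -> dplot U q.
Proof.
move=> [oU H] pq; split=> // i.
rewrite (_ : U `&` _ = U `&` p @^-1` [set i]); first exact: H.
by apply/seteqP; split=> z [Uz /= zi]; split=> //=; rewrite ?pq// -pq.
Qed.

Lemma discD_cst n (U : set 'rV[R]_n) (x : I) : open U -> dplot U (fun=> x).
Proof.
move=> oU; split=> // i; apply: open_local => z [Uz xi].
by exists U; split.
Qed.

Lemma discD_local n (C : set (set 'rV[R]_n)) p :
  (forall V, C V -> dplot V p) -> dplot (\bigcup_(V in C) V) p.
Proof.
move=> H; split; first by apply: bigcup_open => V /H[].
move=> i; rewrite setI_bigcupl; apply: bigcup_open => V /H[_]; exact.
Qed.

Lemma discD_comp n m (U : set 'rV[R]_n) p (V : set 'rV[R]_m)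
    (f : 'rV[R]_m -> 'rV[R]_n) :
  dplot U p -> open V -> smooth_on V f -> (forall z, V z -> U (f z)) ->
  dplot V (p \o f).
Proof.
move=> [oU H] oV sf VU; split=> // i.
rewrite (_ : V `&` _ = V `&` f @^-1` (U `&` p @^-1` [set i])).
  exact: smooth_preimage.
by apply/seteqP; split=> z [Vz] => [/= e|[_ e]]; split=> //; split=> //; exact: VU.
Qed.

Definition discD : diffSpace R :=
  DiffSpace discD_open discD_ext discD_cst discD_local discD_comp.

End DiscreteDiffeology.

Section Sheets.
Context (R : realType) (Y : diffSpace R) (D : set (set Y)).
Context (openD : forall O, D O -> dopen O).

(* the disjoint union of the members of [D], which are their own indices *)
Definition sheets : diffSpace R :=
  @subD R (prodD (discD R (set Y)) Y) (fun Oy => D Oy.1 /\ Oy.1 Oy.2).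

Definition sheets_proj (x : sheets) : Y := (sval x).2.

Lemma sheets_proj_smooth : dsmooth sheets_proj.
Proof. by move=> n U p []. Qed.

Lemma sheet_lift (O : set Y) n (U : set 'rV[R]_n) (p : 'rV[R]_n -> Y) :
  D O -> plot U p -> (forall z, U z -> O (p z)) -> U !=set0 ->
  exists w : 'rV[R]_n -> sheets, plot U w /\
    forall z, U z -> sval (w z) = (O, p z).
Proof.
move=> DO pp UO U0.
have pO : @plot R (prodD (discD R (set Y)) Y) n U (fun z => (O, p z)).
  by split=> //=; apply: (@plot_cst R (discD R (set Y))); exact: plot_open pp.
exact: (plot_sig pO (fun z Uz => conj DO (UO z Uz)) U0).
Qed.

Lemma sheets_proj_local_subduction : local_subduction sheets_proj.
Proof.
move=> n U p z x pp Uz xz; have [DO Ox] := svalP x.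
have oV := openD DO pp.
have Vz : (U `&` p @^-1` (sval x).1) z by split=> //=; rewrite -xz.
have VU : U `&` p @^-1` (sval x).1 `<=` U by move=> y [].
have [w [pw wE]] := sheet_lift DO (plot_sub pp oV VU) (fun y Vy => Vy.2)
  (ex_intro _ z Vz).
exists (U `&` p @^-1` (sval x).1), w; split=> //.
- by move=> y Vy; rewrite /sheets_proj wE.
- by apply: sval_inj; rewrite wE// -xz /sheets_proj; case: (sval x).
Qed.

Lemma sheet_dopen (O O' : set Y) : dopen O' ->
  dopen [set x : sheets | (sval x).1 = O /\ O' (sval x).2].
Proof.
move=> dO' m U p [[_ p1] p2].
rewrite (_ : _ `&` _ = (U `&` (fun z => (sval (p z)).1) @^-1` [set O]) `&`
    (U `&` (fun z => (sval (p z)).2) @^-1` O')).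
  by apply: openI; [exact: p1|exact: dO'].
by apply/seteqP; split=> [z [Uz [e1 e2]]|z [[Uz e1] [_ e2]]].
Qed.

Lemma sheets_manifold : countable D -> manifold Y -> manifold sheets.
Proof.
move=> cD [n [A [mA hA [B cB [oB bB]]]]].
pose AX := [set c : chart R sheets n | dchart c].
have mX : manifold_atlas AX.
  apply: dchart_manifold_atlas => x; have [DO Ox] := svalP x.
  have [c Ac [v cv vE]] := atlas_chart (sval x).2 mA.
  have dc := atlas_dchart mA Ac; have [pc _] := dc.
  have oV := openD DO pc; set V := cdom c `&` _ in oV.
  have Vv : V v by split=> //=; rewrite vE.
  have [c' [[pc' dc'] c'E c'm]] := dchart_restrict dc oV.
  have VE : cdom c' = V by rewrite c'E; apply/seteqP; split=> [y []//|y []].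
  have pV : plot V (cmap c) by apply: plot_sub pc oV _ => y [].
  have [w [pw wE]] := sheet_lift DO pV (fun y Vy => Vy.2) (ex_intro _ v Vv).
  have iw : set_inj V w.
    move=> y y' /set_mem Vy /set_mem Vy' /(congr1 sval); rewrite !wE// => -[].
    by apply: (set_inj_eq (@cmap_inj _ _ _ c)); [case: Vy|case: Vy'].
  exists (Chart oV iw); split; last first.
    by exists v => //=; apply: sval_inj; rewrite wE// vE; case: (sval x).
  split=> // m U p pp; have [[_ p1] p2] := pp.
  have [oW [f [sf fP]]] := dc' _ _ _ p2; rewrite /smooth_in_chart/=.
  set W := U `&` _ in oW sf fP.
  have WE : U `&` p @^-1` (w @` V) =
      W `&` (U `&` (fun z => (sval (p z)).1) @^-1` [set (sval x).1]).
    apply/seteqP; split=> [z [Uz [y Vy yE]]|z [[Uz [y Vy yE]] [_ e]]].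
      have := wE y Vy; rewrite yE => pE.
      split; split=> //=; rewrite pE//=.
      by rewrite VE c'm; exists y.
    rewrite VE in Vy; rewrite c'm in yE.
    split=> //; exists y => //; apply: sval_inj; rewrite wE// yE -e.
    by case: (sval (p z)).
  have oWW : open (W `&` (U `&` (fun z => (sval (p z)).1) @^-1` [set (sval x).1])).
    by apply: openI => //; exact: p1.
  rewrite WE; split=> //; exists f; split; first by apply: (smooth_sub oW oWW _ sf) => y [].
  move=> z Wz.
  have {Wz}[Wz [Uz e]] : (W `&` (U `&` (fun z => (sval (p z)).1) @^-1` [set (sval x).1])) z.
    by rewrite -WE.
  have [Vf fE] := fP z Wz; rewrite VE in Vf; rewrite c'm in fE.
  split=> //; apply: sval_inj; rewrite wE// fE -e.
  by case: (sval (p z)).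
exists n, AX; split=> //.
- rewrite open_hausdorff => x y nxy.
  have xy : x <> y by move=> e; move: nxy; rewrite e eqxx.
  (* Points on different sheets are separated by their sheets; on a common sheet their images
     differ, and open sets of [Y] separating the images are pulled back. *)
  have [e1|ne1] := pselect ((sval x).1 = (sval y).1); last first.
    exists ([set u : sheets | (sval u).1 = (sval x).1 /\ setT (sval u).2],
            [set u : sheets | (sval u).1 = (sval y).1 /\ setT (sval u).2]) => /=.
      by split; apply/mem_set.
    have oT : dopen [set: Y].
      by move=> m U p pp; rewrite preimage_setT setIT; exact: plot_open pp.
    split.
    - by apply/(atlas_space_openP _ mX); exact: (sheet_dopen oT).
    - by apply/(atlas_space_openP _ mX); exact: (sheet_dopen oT).
    by apply/eqP/seteqP; split=> // u [[e _] [e' _]]; apply: ne1; rewrite -e -e'.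
  have e2 : ((sval x).2 : atlas_space A) != (sval y).2.
    apply/eqP => e2; apply: xy; apply: sval_inj.
    by case: (sval x) (sval y) e1 e2 => [? ?] [? ?] /= -> ->.
  move: hA; rewrite open_hausdorff => /(_ _ _ e2)[[P Q] /= [xP yQ] [oP oQ PQ]].
  exists (sheets_proj @^-1` P, sheets_proj @^-1` Q) => /=.
    by split; apply/mem_set; [move/set_mem: xP|move/set_mem: yQ].
  have oo (S : set (atlas_space A)) : open S ->
      open (sheets_proj @^-1` S : set (atlas_space AX)).
    move=> /(atlas_space_openP _ mA) dS; apply/(atlas_space_openP _ mX).
    by move=> m U p /sheets_proj_smooth/dS.
  split; [exact: oo|exact: oo|].
  by rewrite -preimage_setI (eqP PQ) preimage_set0.
(* The countable base: members of [B], placed on each of the countably many sheets. *)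
- pose S (OO : set Y * set Y) : set sheets :=
    [set x | (sval x).1 = OO.1 /\ OO.2 (sval x).2].
  exists (S @` (D `*` B)).
    by apply: sub_countable (card_image_le _ _) _; exact: countableX.
  split=> [_ [[P Q] [/= DP BQ] <-]|x N].
    apply/(atlas_space_openP _ mX); apply: sheet_dopen.
    by apply/(atlas_space_openP _ mA); exact: oB.
  rewrite nbhsE => -[N' [/(atlas_space_openP _ mX) oN' N'x] N'N].
  have [DO Ox] := svalP x; set O := (sval x).1 in DO Ox.
  (* The trace of [N'] on the sheet [O], seen in [Y]; it is open because plots into [O] lift to the
     sheet. *)
  pose M : set (atlas_space A) := [set y | exists2 u : sheets, N' u & sval u = (O, y)].
  have oM : open M.
    apply/(atlas_space_openP _ mA) => m U p pp; apply: open_local => z [Uz [u N'u uE]].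
    have oV := openD DO pp.
    have Vz : (U `&` p @^-1` O) z.
      by split=> //=; have [_] := svalP u; rewrite uE.
    have VU : U `&` p @^-1` O `<=` U by move=> y [].
    have [w [pw wE]] := sheet_lift DO (plot_sub pp oV VU) (fun y Vy => Vy.2)
      (ex_intro _ z Vz).
    exists ((U `&` p @^-1` O) `&` w @^-1` N'); split.
    - exact: oN'.
    - split=> //=; rewrite (_ : w z = u)//.
      by apply: sval_inj; rewrite wE.
    - move=> y [Vy N'w]; split; first by case: Vy.
      by exists (w y) => //; exact: wE.
  have Mx : M (sval x).2 by exists x => //; rewrite /O; case: (sval x).
  have [P [BP Px] PM] := bB _ _ (open_nbhs_nbhs (conj oM Mx)).
  exists (S (O, P)).
    by split; [exists (O, P)|split].
  move=> u [/= e Pu]; apply: N'N; have [u' N'u' u'E] := PM _ Pu.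
  rewrite (_ : u = u')//; apply: sval_inj; rewrite u'E -e.
  by case: (sval u).
Qed.

End Sheets.

(** * Local sections of a subduction; composing and lifting weak equivalences *)

Section WeakEquivalences.
Context (R : realType).
Implicit Types (G H K L : dgroupoid R).

Lemma subduction_section_cover (Z Y : diffSpace R) (F : Z -> Y) :
  subduction F -> manifold Y ->
  exists (X : diffSpace R) (f : X -> Y) (s : X -> Z),
    [/\ manifold X, dsmooth f, local_subduction f,
        set_surj [set: X] [set: Y] f & dsmooth s /\ forall x, F (s x) = f x].
Proof.
move=> subF mY; have [n [A [mA hA [B cB [oB bB]]]]] := mY.
pose good (O : set Y) := exists s : Y -> Z, (forall y, O y -> F (s y) = y) /\
  forall m (U : set 'rV[R]_m) p, plot U p -> (forall z, U z -> O (p z)) ->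
    plot U (s \o p).
(* Sheets are basic open sets with a smooth section, so countability is inherited from the base. *)
pose D : set (set Y) := B `&` good.
have cD : countable D.
  by apply: sub_countable cB; apply: subset_card_le => O [].
have oD O : D O -> dopen O.
  by move=> [BO _]; apply/(atlas_space_openP _ mA); exact: oB.
have covD y : exists2 O, D O & O y.
  have [c Ac [v cv vE]] := atlas_chart y mA.
  have dc := atlas_dchart mA Ac; have [pc _] := dc.
  have [V [q [Vv Vc pq qP]]] := subduction_lift subF pc cv.
  have [c' [dc' c'E c'm]] := dchart_restrict dc (plot_open pq).
  have VE : cdom c' = V.
    by rewrite c'E; apply/seteqP; split=> [z []//|z Vz]; split=> //; exact: Vc.
  have oN : open (cmap c' @` cdom c' : set (atlas_space A)).
    by apply/(atlas_space_openP _ mA); exact: dchart_image_dopen.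
  rewrite VE c'm in oN.
  have Ny : (cmap c @` V) y by exists v.
  have [P [BP Py] PN] := bB _ _ (open_nbhs_nbhs (conj oN Ny)).
  exists P => //; split=> //.
  have /choice[i iP] : forall y, exists v, P y -> V v /\ cmap c v = y.
    move=> y'; have [/PN[w Vw wE]|nPy] := pselect (P y'); last by exists 0.
    by exists w.
  exists (q \o i); split=> [y' /iP[Vi iE]|m U p pp UP].
    by rewrite /= -qP.
  have [oW [f [sf fP]]] := dc'.2 _ _ _ pp.
  have WE : U `&` p @^-1` (cmap c' @` cdom c') = U.
    apply/seteqP; split=> [z []//|z Uz]; split=> //.
    by rewrite VE c'm; exact/PN/UP.
  rewrite WE VE c'm in oW sf fP.
  have pqf := plot_comp pq oW sf (fun z Uz => (fP z Uz).1).
  apply: (plot_ext pqf) => z Uz /=; congr q.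
  have [Vf fE] := fP z Uz; have [Vi iE] := iP _ (UP z Uz).
  by apply: (set_inj_eq (@cmap_inj _ _ _ c)); [exact: Vc|exact: Vc|rewrite fE iE].
have [_ surjF _] := subF.
(* Some function [Y -> Z], the default for sets outside [D]. *)
have /choice[s0 _] : forall y, exists z, F z = y.
  by move=> y; have [z _ zE] := surjF y I; exists z.
have /choice[t tP] : forall O : set Y, exists s : Y -> Z, D O ->
    (forall y, O y -> F (s y) = y) /\
    forall m (U : set 'rV[R]_m) p, plot U p -> (forall z, U z -> O (p z)) ->
      plot U (s \o p).
  move=> O; have [[_ [s sP]]|nD] := pselect (D O); last by exists s0.
  by exists s.
pose s (x : sheets D) := t (sval x).1 (sval x).2.
exists (sheets D), (@sheets_proj R Y D), s; split.
- exact: sheets_manifold.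
- exact: sheets_proj_smooth.
- exact: sheets_proj_local_subduction.
- by move=> y _; have [N DN Ny] := covD y; exists (exist _ (N, y) (conj DN Ny)).
split=> [m U p [[_ p1] p2]|x]; last first.
  by have [DO Ox] := svalP x; have [tF _] := tP _ DO; exact: tF.
apply: plot_cover => z Uz; set O := (sval (p z)).1.
have oV := p1 O; set V := U `&` _ in oV.
exists V; split=> //; first by move=> y [].
have [DO _] := svalP (p z).
have [_ tplot] := tP _ DO.
have pV : plot V (fun y => (sval (p y)).2) by apply: plot_sub p2 oV _ => y [].
have VO y : V y -> O (sval (p y)).2 by move=> [Uy <-]; have [] := svalP (p y).
by apply: (plot_ext (tplot _ _ _ pV VO)) => y [Uy /= e]; rewrite /s e.
Qed.

(** A plot is lifted through [Psi] of [psi], then the resulting objects of [H] through [Psi] of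
    [phi]; composing the two arrows in [K] gives the lift. The inverse of [Phi] is the composite of
    the two inverses. *)
Lemma fcomp_weak_equivalence G H K (psi : dfunctor H K) (phi : dfunctor G H) :
  weak_equivalence psi -> weak_equivalence phi ->
  weak_equivalence (fcomp psi phi).
Proof.
move=> [sPsi dPsi] [sPhi dPhi].
have [L1 [L1P L1s]] := Phi_lift dPsi; have [L2 [L2P L2s]] := Phi_lift dPhi.
have LP x x' h : src h = fob psi (fob phi x) -> tgt h = fob psi (fob phi x') ->
    let k := L2 x x' (L1 (fob phi x) (fob phi x') h) in
    [/\ src k = x, tgt k = x' & far psi (far phi k) = h].
  move=> e e'; have [a1 a2 a3] := L1P _ _ _ e e'.
  by have [b1 b2 b3] := L2P _ _ _ a1 a2; split=> //; rewrite b3.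
split.
  apply: subduction_intro => [|n U p z pp Uz]; first exact: Psi_smooth.
  have [V [q [Vz VU [q1 q2] qP]]] := subduction_lift sPsi pp Uz.
  have [W [r [Wz WV [r1 r2] rP]]] := subduction_lift sPhi q1 Vz.
  have eq y : fob psi (sval (q y)).1 = tgt (sval (q y)).2 := svalP (q y).
  have er y : fob phi (sval (r y)).1 = tgt (sval (r y)).2 := svalP (r y).
  have e y : W y -> src (far psi (sval (r y)).2) = tgt (sval (q y)).2.
    by move=> Wy; rewrite far_src -eq rP.
  pose w y : prodD (ob G) (ar K) :=
    ((sval (r y)).1, cmp (far psi (sval (r y)).2) (sval (q y)).2).
  have pw : plot W w.
    split=> //; apply: plot_cmp => //; first exact: far_smooth.
    by apply: plot_sub q2 _ WV; exact: plot_open r1.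
  have [||v [pv vE]] := plot_sig (X := prodD (ob G) (ar K))
      (P := fun xh => fob (fcomp psi phi) xh.1 = tgt xh.2) pw.
  - by move=> y Wy /=; rewrite tgt_cmp ?e// far_tgt er.
  - by exists z.
  exists W, v; split=> //; first by move=> y /WV/VU.
  by move=> y Wy; rewrite /Psi vE//= src_cmp ?e// qP//; exact: WV.
split; first exact: Phi_smooth.
exists (fun w : Phi_cod (fcomp psi phi) =>
  let z := sval w in L2 z.1.1 z.1.2 (L1 (fob phi z.1.1) (fob phi z.1.2) z.2)).
split.
- move=> k /=.
  have [||k1 k2 k3] := LP (src k) (tgt k) (far psi (far phi k)).
  + by rewrite !far_src.
  + by rewrite !far_tgt.
  apply: (Phi_faithful dPhi) => //; apply: (Phi_faithful dPsi) => //.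
    by rewrite !far_src k1.
  by rewrite !far_tgt k2.
- move=> w; apply: sval_inj => /=; have /= [e e'] := svalP w.
  have [k1 k2 k3] := LP _ _ _ e e'; rewrite k1 k2 k3.
  by case: (sval w) => -[].
- move=> n U p [[p1 p2] p3]; apply: L2s => //=.
    apply: L1s => //=; try exact: fob_smooth.
    by move=> z _; exact: svalP (p z).
  move=> z _; have /= [e e'] := svalP (p z).
  by have [? ? _] := L1P _ _ _ e e'.
Qed.

Lemma induced_functor_weak_equivalence G (X : diffSpace R) (f : X -> ob G)
    (sf : dsmooth f) : local_subduction f -> set_surj [set: X] [set: ob G] f ->
  subductive_weak_equivalence (induced_functor sf).
Proof.
move=> lf surj; have subf := local_subduction_subduction sf surj lf.
split=> //; split; last exact: induced_Phi_diffeomorphism.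
apply: subduction_intro => [|n U p z pp Uz]; first exact: Psi_smooth.
have [V [q [Vz VU pq qP]]] := subduction_lift subf pp Uz.
have pw : @plot R (prodD X (ar G)) n V (fun y => (q y, unt (f (q y)))).
  by split=> //=; exact/unt_smooth/sf.
have [||w [pw' wE]] := plot_sig (X := prodD X (ar G))
    (P := fun xh => f xh.1 = tgt xh.2) pw.
- by move=> y _; rewrite /= tgt_unt.
- by exists z.
exists V, w; split=> //.
by move=> y Vy; rewrite /Psi wE//= src_unt qP.
Qed.

Lemma lift_functor G K (phi : dfunctor K G) (X : diffSpace R) (f : X -> ob G)
    (sf : dsmooth f) (s : X -> ob K) :
  diffeomorphism (@Phi R K G phi) -> dsmooth s -> (forall x, fob phi (s x) = f x) ->
  exists tau : dfunctor (induced_groupoid sf) K, fob tau = s /\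
    forall k, far phi (far tau k) = far (induced_functor sf) k.
Proof.
move=> dPhi ss sE; have [L [LP Ls]] := Phi_lift dPhi.
pose t (k : ar (induced_groupoid sf)) : ar K :=
  L (s (src k)) (s (tgt k)) (far (induced_functor sf) k).
have tP k : [/\ src (t k) = s (src k), tgt (t k) = s (tgt k) &
    far phi (t k) = far (induced_functor sf) k].
  by apply: LP; rewrite sE ?far_src ?far_tgt.
have t_src k : src (t k) = s (src k) by case: (tP k).
have t_tgt k : tgt (t k) = s (tgt k) by case: (tP k).
have t_far k : far phi (t k) = far (induced_functor sf) k by case: (tP k).
(* Functoriality is checked after applying [phi], which is faithful. *)
have t_unt x : t (unt x) = unt (s x).
  apply: (Phi_faithful dPhi); rewrite ?t_src ?t_tgt ?t_far.
  - by rewrite !src_unt.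
  - by rewrite !tgt_unt.
  - by rewrite !far_unt sE.
have t_mul (k l : ar (induced_groupoid sf)) (e : src k = tgt l)
    (e' : src (t k) = tgt (t l)) : t (mul e) = mul e'.
  apply: (Phi_faithful dPhi); rewrite ?t_src ?t_tgt ?t_far.
  - by rewrite !src_mul t_src.
  - by rewrite !tgt_mul t_tgt.
  - by rewrite -!cmpE !far_cmp// !t_far.
have st : dsmooth t.
  move=> n U p pp; apply: Ls; [exact/ss/src_smooth|exact/ss/tgt_smooth|exact: far_smooth|].
  by move=> z _; rewrite !sE far_src far_tgt.
by exists (DFunctor t_src t_tgt t_unt t_mul st).
Qed.

(** A case of two-out-of-three, since [phi] after [tau] is the induced functor. For [Psi], an object
    [p] of [K] and a point [q] with [f q = fob phi p] are joined in [K] by the arrow from [p] to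
    [fob tau q] over a unit. *)
Lemma lift_functor_weak_equivalence G K (phi : dfunctor K G) (X : diffSpace R)
    (f : X -> ob G) (sf : dsmooth f) (tau : dfunctor (induced_groupoid sf) K) :
  diffeomorphism (@Phi R K G phi) -> subduction f ->
  (forall x, fob phi (fob tau x) = f x) ->
  (forall k, far phi (far tau k) = far (induced_functor sf) k) ->
  weak_equivalence tau.
Proof.
move=> dPhi subf tE tE'; have [L [LP Ls]] := Phi_lift dPhi; split.
  apply: subduction_intro => [|n U p z pp Uz]; first exact: Psi_smooth.
  have [V [q [Vz VU pq qP]]] := subduction_lift subf (@fob_smooth R K G phi _ _ _ pp) Uz.
  have pV : plot V p by exact: plot_sub pp (plot_open pq) VU.
  have e y : V y -> src (unt (fob phi (p y))) = fob phi (p y) /\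
      tgt (unt (fob phi (p y))) = fob phi (fob tau (q y)).
    by move=> Vy; rewrite src_unt tgt_unt tE -qP.
  pose w y : prodD X (ar K) := (q y, L (p y) (fob tau (q y)) (unt (fob phi (p y)))).
  have oV := plot_open pq.
  have pw : plot V w.
    split=> //=; apply: Ls => //; first exact: (@fob_smooth R _ _ tau _ _ _ pq).
    exact/unt_smooth/fob_smooth.
  have [||v [pv vE]] := plot_sig (X := prodD X (ar K))
      (P := fun xh => fob tau xh.1 = tgt xh.2) pw.
  - by move=> y Vy; have [e1 e2] := e y Vy; have [_ /= -> _] := LP _ _ _ e1 e2.
  - by exists z.
  exists V, v; split=> // y Vy; rewrite /Psi vE//=.
  by have [e1 e2] := e y Vy; have [-> _ _] := LP _ _ _ e1 e2.
split; first exact: Phi_smooth.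
have eP (w : Phi_cod tau) : src (far phi (sval w).2) = f (sval w).1.1 /\
    tgt (far phi (sval w).2) = f (sval w).1.2.
  by have [e1 e2] := svalP w; rewrite far_src far_tgt e1 e2 !tE.
exists (fun w : Phi_cod tau => exist _ ((sval w).1, far phi (sval w).2) (eP w)
  : ar (induced_groupoid sf)).
split=> [k|w|n U p [[p1 p2] p3]].
- by apply: sval_inj; rewrite /= tE'; move: k => [[[x x'] g] e].
- apply: sval_inj => /=; have /= [e1 e2] := svalP w.
  rewrite (_ : far tau _ = (sval w).2); first by case: (sval w) => -[].
  by apply: (Phi_faithful dPhi); rewrite ?far_src ?far_tgt ?e1 ?e2 ?tE'.
- by split; [split|exact: far_smooth].
Qed.

End WeakEquivalences.

(** * Lie structure of the new anafunctor, and the transformation *)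

Section LieGroupoids.
Context (R : realType).
Implicit Types (G H K : dgroupoid R).

Lemma manifold_weak_manifold (X : diffSpace R) : manifold X -> weak_manifold X.
Proof. by move=> [n [A [mA _ _]]]; exists n, A. Qed.

Lemma lie_weak_equivalence_intro G H (phi : dfunctor G H) :
  lie_groupoid G -> lie_groupoid H -> weak_equivalence phi ->
  lie_weak_equivalence phi.
Proof.
move=> [/manifold_weak_manifold mG wG _ tG] [/manifold_weak_manifold mH _ _ tH] we.
have wPsi : weak_manifold (Psi_dom phi).
  by apply: fibD_weak_manifold => //; exact: fob_smooth.
split=> //.
- by split; [exact: diffeomorphism_weak_manifold we.2 wG|exact: Phi_smooth].
- by split=> //; exact: Psi_smooth.
- apply: local_subduction_submersion => //; first exact: Psi_smooth.
  exact/Psi_local_subduction/submersion_local_subduction.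
Qed.

Lemma induced_weak_manifold G (X : diffSpace R) (f : X -> ob G) (sf : dsmooth f) :
  lie_groupoid G -> weak_manifold X -> local_subduction f ->
  weak_manifold (ar (induced_groupoid sf)).
Proof.
move=> [mG _ sG _] mX lf.
have wG := manifold_weak_manifold mG.
have sub_f : submersion f by exact: local_subduction_submersion.
(* The space of arrows is an iterated fibre product: [Y1] pairs a point with an arrow out of its
   image, then a point over the target is added. The first is taken along [src], the second along
   [f], both submersions. *)
pose Y1 := fibD f (@src R G).
pose t (u : Y1) : ob G := tgt (sval u).2.
have st : dsmooth t by move=> n U p [_ p2]; exact: tgt_smooth.
have wY1 : weak_manifold Y1 by exact: fibD_weak_manifold.
have wY2 : weak_manifold (fibD t f) by exact: fibD_weak_manifold.
have e1 (u : fibD t f) : src (sval (sval u).1).2 = f (sval (sval u).1).1 /\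
    tgt (sval (sval u).1).2 = f (sval u).2.
  by split; [exact: esym (svalP (sval u).1)|exact: svalP u].
have e2 (k : ar (induced_groupoid sf)) : f (sval k).1.1 = src (sval k).2.
  by case: (svalP k).
have e3 (k : ar (induced_groupoid sf)) :
    t (exist _ ((sval k).1.1, (sval k).2) (e2 k)) = f (sval k).1.2.
  by case: (svalP k).
apply: (@diffeomorphism_weak_manifold _ (fibD t f) _ (fun u =>
  exist _ (((sval (sval u).1).1, (sval u).2), (sval (sval u).1).2) (e1 u)
    : ar (induced_groupoid sf))) => //.
split; first by move=> n U p [[p1 p2] p3]; split; first split.
exists (fun k : ar (induced_groupoid sf) =>
  exist _ (exist _ ((sval k).1.1, (sval k).2) (e2 k), (sval k).1.2) (e3 k)
    : fibD t f); split.
- by move=> [[[[x g] e] x'] e']; apply: sval_inj => /=; congr pair; exact: sval_inj.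
- by move=> [[[x x'] g] e]; exact: sval_inj.
- by move=> n U p [[p1 p2] p3]; split; first split.
Qed.

Lemma induced_lie_groupoid G (X : diffSpace R) (f : X -> ob G) (sf : dsmooth f) :
  lie_groupoid G -> manifold X -> local_subduction f ->
  lie_groupoid (induced_groupoid sf).
Proof.
move=> lieG mX lf; have wX := manifold_weak_manifold mX.
have wa : weak_manifold (ar (induced_groupoid sf)) by exact: induced_weak_manifold.
have lt : local_subduction (@tgt R (induced_groupoid sf)).
  apply: induced_tgt_local_subduction => //.
  by case: lieG => _ _ _; exact: submersion_local_subduction.
split=> //; apply: local_subduction_submersion => //.
- exact: src_smooth.
- exact: induced_src_local_subduction.
- exact: tgt_smooth.
Qed.

Lemma lift_functor_transformation G H (M : anafunctor G H) (X : diffSpace R)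
    (f : X -> ob G) (sf : dsmooth f) (tau : dfunctor (induced_groupoid sf) (apex M))
    (swe : subductive_weak_equivalence (induced_functor sf)) :
  (forall x, fob (aleft M) (fob tau x) = f x) ->
  (forall k, far (aleft M) (far tau k) = far (induced_functor sf) k) ->
  exists S : ob (pullback (aleft M) (induced_functor sf)) -> ar H,
    @transformation R G H M (Anafunctor (fcomp (aright M) tau) swe) S.
Proof.
move=> tE tE'; have [[_ dPhi] _] := aleft_swe M.
have [L [LP Ls]] := Phi_lift dPhi.
set phi := aleft M in tE tE' dPhi L LP Ls *; set psi := aright M.
pose P := pullback phi (induced_functor sf).
pose l (x : ob P) := L (sval x).1 (fob tau (sval x).2) (unt (fob phi (sval x).1)).
have e x : src (unt (fob phi (sval x).1)) = fob phi (sval (x : ob P)).1 /\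
    tgt (unt (fob phi (sval x).1)) = fob phi (fob tau (sval x).2).
  by rewrite src_unt tgt_unt tE; split=> //; exact: svalP x.
have lP (x : ob P) : [/\ src (l x) = (sval x).1, tgt (l x) = fob tau (sval x).2 &
    far phi (l x) = unt (fob phi (sval x).1)].
  by have [e1 e2] := e x; exact: LP.
have sl : dsmooth l.
  move=> n U p [p1 p2]; apply: Ls => //; first exact: fob_smooth p2.
  exact/unt_smooth/fob_smooth.
exists (fun x => far psi (l x)); split.
- by move=> n U p /sl; exact: far_smooth.
- by move=> x; rewrite far_src; have [-> _ _] := lP x.
- by move=> x; rewrite far_tgt; have [_ -> _] := lP x.
move=> g e1 e2; rewrite -!cmpE /=.
have [s1 t1 f1] := lP (tgt g); have [s2 t2 f2] := lP (src g).
have c1 : src (l (tgt g)) = tgt (sval g).1 by rewrite s1.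
have c2 : src (far tau (sval g).2) = tgt (l (src g)) by rewrite t2 far_src.
(* Naturality already holds in [K]: the two composites are parallel, and as [l] lies over units they
   have the same image in [G]. *)
rewrite -!far_cmp//; congr (far psi _); apply: (Phi_faithful dPhi).
- by rewrite !src_cmp// s2.
- by rewrite !tgt_cmp// t1 far_tgt.
- rewrite !far_cmp// f1 f2 cmp1g; last by rewrite far_tgt.
  rewrite cmpg1 ?tE'; first exact: svalP g.
  by rewrite far_src -(svalP (src g)).
Qed.

End LieGroupoids.

Theorem corollary5p10 (R : realType) (G H : dgroupoid R)
    (lieG : lie_groupoid G) (lieH : lie_groupoid H) :
  (forall M : anafunctor G H, is_morita M ->
     exists N : anafunctor G H,
       lie_anafunctor N /\ is_morita N /\ lie_weak_equivalence (aright N) /\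
       exists S : ob (pullback (aleft M) (aleft N)) -> ar H,
         transformation S) /\
  (morita_equivalent G H <-> lie_morita_equivalent G H).
Proof.
have main (M : anafunctor G H) : is_morita M ->
    exists N : anafunctor G H,
      lie_anafunctor N /\ is_morita N /\ lie_weak_equivalence (aright N) /\
      exists S : ob (pullback (aleft M) (aleft N)) -> ar H, transformation S.
  move=> morM; have [[_ dPhi] sub0] := aleft_swe M; have [mG _ _ _] := lieG.
  have [X [f [s [mX sf lf surj [ss sE]]]]] := subduction_section_cover sub0 mG.
  have [tau [tau0 tau1]] := lift_functor sf dPhi ss sE.
  have tE x : fob (aleft M) (fob tau x) = f x by rewrite tau0.
  have swe := induced_functor_weak_equivalence sf lf surj.
  have lieK := induced_lie_groupoid sf lieG mX lf.
  have we : weak_equivalence (fcomp (aright M) tau).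
    apply: fcomp_weak_equivalence => //.
    by apply: (lift_functor_weak_equivalence dPhi _ tE tau1); case: swe.
  exists (Anafunctor (fcomp (aright M) tau) swe); split; last split=> //.
    split=> //; split=> //.
    - by apply: lie_weak_equivalence_intro => //; case: swe.
    - by apply: local_subduction_submersion => //; exact: manifold_weak_manifold.
  split; first exact: lie_weak_equivalence_intro.
  exact: lift_functor_transformation.
(* For the converse, a Lie Morita equivalence is already a diffeological one, since being a weak
   equivalence is part of [lie_weak_equivalence]. *)
split=> //; split=> [[M /main[N [lN [_ [lwN _]]]]]|[M [_ [we _ _ _]]]].
  by exists N.
by exists M.
Qed.
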